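(* Let $M=T^*S^1\times T^*S^1$ with points $(z,p,w,J)$, $z=e^{i\varphi}$, $w=e^{i\psi}$, $p,J\in\mathbb R$, symplectic form $\omega=-d\varphi\wedge dp+d\psi\wedge dJ$, and the free proper Hamiltonian $U(1)$-action with momentum map $J$, so that $C=J^{-1}(\{0\})\cong T^*S^1\times S^1$ with coordinates $(z,p,w)$ is a regular constraint surface, with reduced phase space $M_{\mathrm{red}}=T^*S^1$. Let $$f*g=\mu\circ\exp\Big(\tfrac{\lambda}{i}\big(\tfrac{\partial}{\partial\varphi}\otimes\tfrac{\partial}{\partial p}+\tfrac{\partial}{\partial J}\otimes\tfrac{\partial}{\partial\psi}\big)\Big)(f\otimes g)$$ ($\mu$ = pointwise multiplication), $S=\exp(\lambda p\,\partial/\partial J)$, and let $\tilde *$ be the star product $f\,\tilde *\,g=S(S^{-1}f*S^{-1}g)$ equivalent to $*$. Then for the Hamiltonian quantum $\mathfrak u(1)$-space $(M,\tilde *,\mathfrak u(1),J,C)$ the quantum representation on $C^\infty(C)[[\lambda]]$ is $$\tilde{\boldsymbol\varrho}_C\,u=-\frac{\partial u}{\partial\psi}-\lambda\frac{\partial u}{\partial\varphi},$$ an element $u\in C^\infty(C)[[\lambda]]$ satisfies $\tilde{\boldsymbol\varrho}_Cu=0$ if and only if $u$ depends only on $p$, and consequently $(M,\tilde *,\mathfrak u(1),J,C)$ does not admit a consistent quantum reduction.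
   Context: Functions are complex-valued; Poisson bracket $\{f,g\}=\omega(X_f,X_g)$ with $i_{X_f}\omega=df$, so $\{J,f\}=-\partial f/\partial\psi$ and $\{p,f\}=\partial f/\partial\varphi$. $\mathfrak u(1)\cong\mathbb R$ is one-dimensional and abelian. $\iota:C\to M$, $(z,p,w)\mapsto(z,p,w,0)$. The classical invariants $C^\infty(C)^{\mathfrak u(1)}$ are the $u\in C^\infty(C)$ with $\partial u/\partial\psi=0$. Quantum representation on $C$: with $(\mathrm{prol}\,u)(z,p,w,J)=u(z,p,w)$, $(h_0f)(z,p,w,J)=\frac{f(z,p,w,J)-f(z,p,w,0)}{J}$ (extended smoothly to $J=0$), $\partial_1f=Jf$, $\tilde{\boldsymbol\partial}_1f=f\,\tilde *\,J$, $B_1=\frac1\lambda(\partial_1-\tilde{\boldsymbol\partial}_1)$, put $\boldsymbol\iota^*=\iota^*(\mathrm{id}-\lambda B_1h_0)^{-1}:C^\infty(M)[[\lambda]]\to C^\infty(C)[[\lambda]]$, $\tilde{\boldsymbol\varrho}_Mf=\frac1{i\lambda}(J\,\tilde *\,f-f\,\tilde *\,J)$ and $\tilde{\boldsymbol\varrho}_C=\boldsymbol\iota^*\tilde{\boldsymbol\varrho}_M\,\mathrm{prol}$. Consistent quantum reduction means: the $\mathbb C[[\lambda]]$-submodule $\{u\in C^\infty(C)[[\lambda]]:\tilde{\boldsymbol\varrho}_Cu=0\}$ is a deformation of $C^\infty(C)^{\mathfrak u(1)}\subset C^\infty(C)$, where a submodule $\mathbf W\subset V[[\lambda]]$ is a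 deformation of a subspace $W\subset V$ if $\mathbf W=\mathbf E(W[[\lambda]])$ for some formal series of linear maps $\mathbf E=\sum_r\lambda^r\mathbf E_r$, $\mathbf E_r:W\to V$, with $\mathbf E_0$ the inclusion. *)

(* Defs.v *)
From Stdlib Require Import Reals Factorial Wf_nat Lra Lia.
From Stdlib Require Import FunctionalExtensionality ProofIrrelevance ClassicalEpsilon.
From Coquelicot Require Import Coquelicot.
Open Scope R_scope.

(** [flow i t] is the time-[t] flow of the [i]-th coordinate vector field, for
    instance [z |-> exp(i t) z] for [d/dphi] and [p |-> p + t] for [d/dp]. *)
Record framed := Framed {
  space :> UniformSpace;
  coord : Type;
  flow : coord -> R -> space -> space;
  flow_0 : forall i x, flow i 0 x = x;
  flow_add : forall i s t x, flow i (s + t) x = flow i s (flow i t x);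
  flow_cont : forall i t x,
    continuous (fun y : R * space => flow i (fst y) (snd y)) (t, x)
}.
Arguments coord : clear implicits.
Arguments flow {_} _ _ _.

Definition dir {X : framed} (i : coord X) (f : X -> R) (x : X) : R :=
  Derive (fun t => f (flow i t x)) 0.

Fixpoint Ck {X : framed} (n : nat) (f : X -> R) : Prop :=
  (forall x, continuous f x) /\
  match n with
  | O => True
  | S m => forall i : coord X,
      (forall x, ex_derive (fun t => f (flow i t x)) 0) /\ Ck m (dir i f)
  end.

(** As the coordinate fields form a frame, this is smoothness in the usual
    sense: all iterated partial derivatives of the real and imaginary parts
    exist and are continuous. *)
Definition smooth {X : framed} (f : X -> C) : Prop :=
  forall n, Ck n (fun x => Re (f x)) /\ Ck n (fun x => Im (f x)).

Lemma Ck_cont (X : framed) n (f : X -> R) x : Ck n f -> continuous f x.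
Proof. destruct n; intros [H _]; exact (H x). Qed.

Lemma Ck_step (X : framed) n (f : X -> R) (g : coord X -> X -> R) :
  (forall x, continuous f x) ->
  (forall i x, is_derive (fun t => f (flow i t x)) 0 (g i x)) ->
  (forall i, Ck n (g i)) -> Ck (S n) f.
Proof.
intros Hc Hd Hg. split; [exact Hc|]. intros i. split.
- intros x. eexists. apply Hd.
- replace (dir i f) with (g i); [apply Hg|].
  apply functional_extensionality; intros x. symmetry.
  apply is_derive_unique, Hd.
Qed.

Lemma Ck_dir (X : framed) n (f : X -> R) i x : Ck (S n) f ->
  is_derive (fun t => f (flow i t x)) 0 (dir i f x).
Proof. intros [_ H]. apply Derive_correct. exact (proj1 (H i) x). Qed.

Lemma Ck_dir_Ck (X : framed) n (f : X -> R) i : Ck (S n) f -> Ck n (dir i f).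
Proof. intros [_ H]. exact (proj2 (H i)). Qed.

Lemma Ck_pred (X : framed) n : forall f : X -> R, Ck (S n) f -> Ck n f.
Proof.
induction n; intros f [Hc H].
- split; [exact Hc | exact I].
- split; [exact Hc|]. intros i. destruct (H i) as [H1 H2].
  split; [exact H1 | exact (IHn _ H2)].
Qed.

Lemma is_derive_cst (c x : R) : is_derive (fun _ : R => c) x 0.
Proof. apply (is_derive_const (K := R_AbsRing) (V := R_NormedModule)). Qed.

Lemma Ck_const (X : framed) n c : @Ck X n (fun _ => c).
Proof.
revert c; induction n; intros c.
- split; [intros; apply continuous_const | exact I].
- apply Ck_step with (g := fun _ _ => 0).
  + intros; apply continuous_const.
  + intros. apply is_derive_cst.
  + intros; apply IHn.
Qed.

Lemma Ck_plus (X : framed) n : forall f g : X -> R,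
  Ck n f -> Ck n g -> Ck n (fun x => f x + g x).
Proof.
induction n; intros f g Hf Hg.
- split; [|exact I]. intros x.
  apply (continuous_plus (V := R_NormedModule)); eapply Ck_cont; eassumption.
- apply Ck_step with (g := fun i x => dir i f x + dir i g x).
  + intros x.
    apply (continuous_plus (V := R_NormedModule)); eapply Ck_cont; eassumption.
  + intros i x. apply (is_derive_plus (V := R_NormedModule));
      eapply Ck_dir; eassumption.
  + intros i. apply IHn; apply Ck_dir_Ck; assumption.
Qed.

Lemma Ck_mult (X : framed) n : forall f g : X -> R,
  Ck n f -> Ck n g -> Ck n (fun x => f x * g x).
Proof.
induction n; intros f g Hf Hg.
- split; [|exact I]. intros x.
  apply (continuous_mult (K := R_AbsRing)); eapply Ck_cont; eassumption.
- apply Ck_step with (g := fun i x => dir i f x * g x + f x * dir i g x).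
  + intros x.
    apply (continuous_mult (K := R_AbsRing)); eapply Ck_cont; eassumption.
  + intros i x.
    generalize (is_derive_mult (K := R_AbsRing) _ _ _ _ _ (Ck_dir X n f i x Hf)
      (Ck_dir X n g i x Hg) Rmult_comm).
    rewrite (flow_0 X). exact (fun h => h).
  + intros i. apply Ck_plus; apply IHn;
      first [apply Ck_dir_Ck; assumption | apply Ck_pred; assumption].
Qed.

Lemma Ck_scal (X : framed) n c (f : X -> R) : Ck n f -> Ck n (fun x => c * f x).
Proof. intros H. apply Ck_mult; [apply Ck_const | exact H]. Qed.

Lemma Ck_opp (X : framed) n (f : X -> R) : Ck n f -> Ck n (fun x => - f x).
Proof.
intros H. replace (fun x => - f x) with (fun x => (-1) * f x).
- apply Ck_scal, H.
- apply functional_extensionality; intros; ring.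
Qed.

Record Cinf (X : framed) := MkCinf {
  fn :> X -> C;
  fn_smooth : smooth fn
}.
Arguments MkCinf {X} _ _.
Arguments fn {X} _ _.
Arguments fn_smooth {X} _ _.

Lemma Cinf_ext (X : framed) (f g : Cinf X) : (forall x, f x = g x) -> f = g.
Proof.
destruct f as [f Hf], g as [g Hg]; simpl; intros H.
assert (E : f = g) by (apply functional_extensionality; exact H).
subst g. f_equal. apply proof_irrelevance.
Qed.

Lemma smooth_const (X : framed) c : smooth (fun _ : X => c).
Proof. intros n. split; apply Ck_const. Qed.

Lemma smooth_plus (X : framed) (f g : X -> C) :
  smooth f -> smooth g -> smooth (fun x => f x + g x)%C.
Proof.
intros Hf Hg n.
split; [exact (Ck_plus X n _ _ (proj1 (Hf n)) (proj1 (Hg n)))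
       |exact (Ck_plus X n _ _ (proj2 (Hf n)) (proj2 (Hg n)))].
Qed.

Lemma smooth_mult (X : framed) (f g : X -> C) :
  smooth f -> smooth g -> smooth (fun x => f x * g x)%C.
Proof.
intros Hf Hg n. destruct (Hf n) as [Hf1 Hf2], (Hg n) as [Hg1 Hg2]. split.
- exact (Ck_plus X n _ _ (Ck_mult X n _ _ Hf1 Hg1)
           (Ck_opp X n _ (Ck_mult X n _ _ Hf2 Hg2))).
- exact (Ck_plus X n _ _ (Ck_mult X n _ _ Hf1 Hg2) (Ck_mult X n _ _ Hf2 Hg1)).
Qed.

Lemma smooth_opp (X : framed) (f : X -> C) :
  smooth f -> smooth (fun x => - f x)%C.
Proof.
intros Hf n.
split; [exact (Ck_opp X n _ (proj1 (Hf n))) | exact (Ck_opp X n _ (proj2 (Hf n)))].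
Qed.

Definition cinf_const {X : framed} (c : C) : Cinf X :=
  MkCinf _ (smooth_const X c).
Definition cinf_plus {X : framed} (f g : Cinf X) : Cinf X :=
  MkCinf _ (smooth_plus X f g (fn_smooth f) (fn_smooth g)).
Definition cinf_opp {X : framed} (f : Cinf X) : Cinf X :=
  MkCinf _ (smooth_opp X f (fn_smooth f)).
Definition cinf_mult {X : framed} (f g : Cinf X) : Cinf X :=
  MkCinf _ (smooth_mult X f g (fn_smooth f) (fn_smooth g)).
Definition cinf_scal {X : framed} (c : C) (f : Cinf X) : Cinf X :=
  cinf_mult (cinf_const c) f.

Section CinfModule.
Variable X : framed.

Lemma cinf_plus_comm (f g : Cinf X) : cinf_plus f g = cinf_plus g f.
Proof. apply Cinf_ext; intros x; simpl; ring. Qed.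
Lemma cinf_plus_assoc (f g h : Cinf X) :
  cinf_plus f (cinf_plus g h) = cinf_plus (cinf_plus f g) h.
Proof. apply Cinf_ext; intros x; simpl; ring. Qed.
Lemma cinf_plus_0 (f : Cinf X) : cinf_plus f (cinf_const 0) = f.
Proof. apply Cinf_ext; intros x; simpl; ring. Qed.
Lemma cinf_plus_opp (f : Cinf X) : cinf_plus f (cinf_opp f) = cinf_const 0.
Proof. apply Cinf_ext; intros x; simpl; ring. Qed.

Definition Cinf_AbelianMonoid_mixin :=
  AbelianMonoid.Mixin (Cinf X) cinf_plus (cinf_const 0)
    cinf_plus_comm cinf_plus_assoc cinf_plus_0.
Canonical Cinf_AbelianMonoid :=
  AbelianMonoid.Pack (Cinf X) Cinf_AbelianMonoid_mixin (Cinf X).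
Definition Cinf_AbelianGroup_mixin :=
  AbelianGroup.Mixin Cinf_AbelianMonoid cinf_opp cinf_plus_opp.
Canonical Cinf_AbelianGroup :=
  AbelianGroup.Pack (Cinf X)
    (AbelianGroup.Class _ _ Cinf_AbelianGroup_mixin) (Cinf X).

Lemma cinf_scal_assoc (a b : C_Ring) (f : Cinf X) :
  cinf_scal a (cinf_scal b f) = cinf_scal (mult a b) f.
Proof. apply Cinf_ext; intros x; simpl; unfold mult; simpl; ring. Qed.
Lemma cinf_scal_one (f : Cinf X) : cinf_scal (@one C_Ring) f = f.
Proof. apply Cinf_ext; intros x; simpl; unfold one; simpl; ring. Qed.
Lemma cinf_scal_plus_r (a : C_Ring) (f g : Cinf X) :
  cinf_scal a (plus f g) = plus (cinf_scal a f) (cinf_scal a g).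
Proof. apply Cinf_ext; intros x; simpl; ring. Qed.
Lemma cinf_scal_plus_l (a b : C_Ring) (f : Cinf X) :
  cinf_scal (plus a b) f = plus (cinf_scal a f) (cinf_scal b f).
Proof. apply Cinf_ext; intros x; simpl; unfold plus; simpl; ring. Qed.

Definition Cinf_ModuleSpace_mixin :=
  ModuleSpace.Mixin C_Ring Cinf_AbelianGroup cinf_scal
    cinf_scal_assoc cinf_scal_one cinf_scal_plus_r cinf_scal_plus_l.
Canonical Cinf_ModuleSpace :=
  ModuleSpace.Pack C_Ring (Cinf X)
    (ModuleSpace.Class C_Ring (Cinf X) _ Cinf_ModuleSpace_mixin) (Cinf X).
End CinfModule.

Lemma smooth_deriv (X : framed) (i : coord X) (f : X -> C) : smooth f ->
  smooth (fun x => (dir i (fun y => Re (f y)) x, dir i (fun y => Im (f y)) x)).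
Proof.
intros Hf n. destruct (Hf (S n)) as [H1 H2].
split; [exact (Ck_dir_Ck X n _ i H1) | exact (Ck_dir_Ck X n _ i H2)].
Qed.

Definition pd {X : framed} (i : coord X) (f : Cinf X) : Cinf X :=
  MkCinf _ (smooth_deriv X i f (fn_smooth f)).

Section Cylinder.
Variable X : framed.

Definition cyl_flow (i : option (coord X)) (t : R) (y : X * R) : X * R :=
  match i with
  | Some i => (flow i t (fst y), snd y)
  | None => (fst y, snd y + t)
  end.

Lemma cyl_flow_0 i y : cyl_flow i 0 y = y.
Proof.
destruct y as [x j], i as [i|]; simpl.
- now rewrite flow_0.
- now rewrite Rplus_0_r.
Qed.

Lemma cyl_flow_add i s t y : cyl_flow i (s + t) y = cyl_flow i s (cyl_flow i t y).
Proof.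
destruct y as [x j], i as [i|]; simpl.
- now rewrite flow_add.
- f_equal; ring.
Qed.

Lemma continuous_pair (T U V : UniformSpace) (f : T -> U) (g : T -> V) x :
  continuous f x -> continuous g x -> continuous (fun y => (f y, g y)) x.
Proof.
intros Hf Hg.
apply (continuous_comp_2 f g (fun u v => (u, v)) x Hf Hg).
apply continuous_ext with (f := fun z => z); [now intros [u v] | apply continuous_id].
Qed.

Lemma cont_fst (U V : UniformSpace) (z : U * V) : continuous fst z.
Proof. destruct z; apply continuous_fst. Qed.
Lemma cont_snd (U V : UniformSpace) (z : U * V) : continuous snd z.
Proof. destruct z; apply continuous_snd. Qed.

Lemma cyl_flow_cont i t (y : prod_UniformSpace X R_UniformSpace) :
  continuous (fun z : R * prod_UniformSpace X R_UniformSpace =>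
                (cyl_flow i (fst z) (snd z) : prod_UniformSpace X R_UniformSpace)) (t, y).
Proof.
destruct i as [i|]; unfold cyl_flow; apply continuous_pair.
- apply (continuous_comp_2 (fun z : R * (X * R) => fst z)
    (fun z : R * (X * R) => fst (snd z)) (fun a b => flow i a b)).
  + apply cont_fst.
  + apply (continuous_comp snd fst); [apply cont_snd | apply cont_fst].
  + apply flow_cont.
- apply (continuous_comp snd snd); apply cont_snd.
- apply (continuous_comp snd fst); [apply cont_snd | apply cont_fst].
- apply (continuous_plus (V := R_NormedModule)
    (fun z : R * (X * R) => snd (snd z)) (fun z : R * (X * R) => fst z)).
  + apply (continuous_comp snd snd); apply cont_snd.
  + apply cont_fst.
Qed.

Definition cyl : framed :=
  Framed (prod_UniformSpace X R_UniformSpace) (option (coord X)) cyl_flow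
    cyl_flow_0 cyl_flow_add cyl_flow_cont.

Lemma Ck_fst n : forall f : X -> R, Ck n f -> @Ck cyl n (fun y => f (fst y)).
Proof.
assert (Hc : forall f : X -> R, (forall x, continuous f x) ->
  forall y : cyl, continuous (fun y : cyl => f (fst y)) y).
{ intros f Hf y. apply (continuous_comp (fst : cyl -> X) f y);
    [apply cont_fst | apply Hf]. }
induction n; intros f Hf.
- split; [|exact I]. apply Hc. intros x; eapply Ck_cont; exact Hf.
- apply (Ck_step cyl) with (g := fun i y =>
    match i with Some i => dir i f (fst y) | None => 0 end).
  + apply Hc. intros x; eapply Ck_cont; exact Hf.
  + intros [i|] y.
    * exact (Ck_dir X n f i (fst y) Hf).
    * exact (is_derive_cst (f (fst y)) 0).
  + intros [i|].
    * apply (IHn (dir i f)), Ck_dir_Ck, Hf.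
    * apply Ck_const.
Qed.

Lemma Ck_zero_section n : forall f : cyl -> R,
  Ck n f -> @Ck X n (fun x => f (x, 0)).
Proof.
assert (Hc : forall f : cyl -> R, (forall x, continuous f x) ->
  forall x, continuous (fun x : X => f (x, 0)) x).
{ intros f Hf x. apply (continuous_comp (fun x : X => (x, 0) : cyl) f x);
    [|apply Hf].
  apply (continuous_pair X X R_UniformSpace);
    [apply continuous_id | apply continuous_const]. }
induction n; intros f Hf.
- split; [|exact I]. apply Hc. intros x; eapply Ck_cont; exact Hf.
- apply (Ck_step X) with (g := fun i x => dir (X := cyl) (Some i) f (x, 0)).
  + apply Hc. intros x; eapply Ck_cont; exact Hf.
  + intros i x. exact (Ck_dir cyl n f (Some i) (x, 0) Hf).
  + intros i. exact (IHn _ (Ck_dir_Ck cyl n f (Some i) Hf)).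
Qed.

Lemma Ck_snd n : @Ck cyl n (fun y => snd y).
Proof.
destruct n.
- split; [|exact I]. intros; apply cont_snd.
- apply (Ck_step cyl) with (g := fun i _ =>
    match i with Some _ => 0 | None => 1 end).
  + intros; apply cont_snd.
  + intros [i|] y.
    * exact (is_derive_cst (snd y) 0).
    * simpl. auto_derive; [exact I | reflexivity].
  + intros [i|]; apply Ck_const.
Qed.

Lemma continuous_RInt_param (Y : UniformSpace) (G : Y * R -> R) y :
  (forall z, continuous G z) ->
  continuous (fun y => RInt (fun t => G (y, t)) 0 1) y.
Proof.
intros HG.
assert (Hint : forall y, ex_RInt (fun t => G (y, t)) 0 1).
{ intros y'. apply (ex_RInt_continuous (V := R_CompleteNormedModule)).
  intros t _. apply (continuous_comp (fun t : R => (y', t) : Y * R) G t);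
    [|apply HG].
  apply continuous_pair; [apply continuous_const | apply continuous_id]. }
apply filterlim_locally. intros eps.
assert (Hd : forall t : R, exists d : posreal, forall y' t',
  ball y d y' -> Rabs (t' - t) < d -> Rabs (G (y', t') - G (y, t)) < eps / 4).
{ intros t. assert (H4 : 0 < eps / 4) by (generalize (cond_pos eps); lra).
  destruct (proj1 (filterlim_locally G (G (y, t))) (HG (y, t)) (mkposreal _ H4))
    as [d Hd].
  exists d. intros y' t' H1 H2. apply (Hd (y', t')). split; [exact H1 | exact H2]. }
pose (delta t := proj1_sig (constructive_indefinite_description _ (Hd t))).
assert (Hdelta := fun t => proj2_sig (constructive_indefinite_description _ (Hd t))).
change (forall t y' t', ball y (delta t) y' -> Rabs (t' - t) < delta t ->
  Rabs (G (y', t') - G (y, t)) < eps / 4) in Hdelta.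
destruct (compactness_value_1d 0 1 delta) as [d Hd1].
exists d. intros y' Hy'.
assert (Hb : forall t, 0 <= t <= 1 -> Rabs (G (y', t) - G (y, t)) <= eps / 2).
{ intros t Ht. apply Rnot_lt_le. intros Hlt. apply (Hd1 t Ht).
  intros (s & Hs & Hst & Hds). apply (Rlt_irrefl (eps / 2)).
  eapply Rlt_trans; [exact Hlt|].
  replace (G (y', t) - G (y, t))
    with ((G (y', t) - G (y, s)) - (G (y, t) - G (y, s))) by ring.
  eapply Rle_lt_trans; [apply Rabs_triang|]. rewrite Rabs_Ropp.
  assert (H1 := Hdelta s y' t (ball_le _ _ _ Hds _ Hy') Hst).
  assert (H2 := Hdelta s y t (ball_center _ _) Hst). lra. }
assert (Hle : Rabs (RInt (fun t => G (y', t) - G (y, t)) 0 1)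
              <= (1 - 0) * (eps / 2)).
{ apply abs_RInt_le_const; [lra | | exact Hb].
  apply (ex_RInt_minus (V := R_NormedModule)); apply Hint. }
rewrite (RInt_minus (V := R_CompleteNormedModule)) in Hle by apply Hint.
unfold ball; simpl; unfold AbsRing_ball; simpl.
eapply Rle_lt_trans; [exact Hle|]. generalize (cond_pos eps); lra.
Qed.

Lemma is_derive_Rcomp (f g : R -> R) x l m :
  is_derive f (g x) l -> is_derive g x m ->
  is_derive (fun v => f (g v)) x (m * l).
Proof. exact (is_derive_comp (K := R_AbsRing) (V := R_NormedModule) f g x l m). Qed.

Lemma flow_derive (Y : framed) (g : Y -> R) i y s : Ck 1 g ->
  is_derive (fun t => g (flow i t y)) s (dir i g (flow i s y)).
Proof.
intros Hg.
apply is_derive_ext with (f := fun t => g (flow i (t - s) (flow i s y))).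
{ intros t. rewrite <- flow_add. do 2 f_equal. ring. }
assert (H : is_derive (fun t => g (flow i t (flow i s y))) (s - s)
              (dir i g (flow i s y))).
{ replace (s - s) with 0 by ring. exact (Ck_dir Y 0 g i _ Hg). }
assert (Hs : is_derive (fun t => t - s) s 1) by (auto_derive; [exact I | ring]).
rewrite <- (Rmult_1_l (dir i g (flow i s y))).
exact (is_derive_Rcomp (fun t => g (flow i t (flow i s y))) (fun t => t - s)
         s _ _ H Hs).
Qed.

Lemma RInt_param_derive (G D : R -> R -> R) :
  (forall u t, is_derive (fun u => G u t) u (D u t)) ->
  (forall u t, continuous (fun z : R * R => D (fst z) (snd z)) (u, t)) ->
  (forall u t, continuous (G u) t) ->
  is_derive (fun u => RInt (G u) 0 1) 0 (RInt (D 0) 0 1).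
Proof.
intros HD HcD HcG.
assert (E : forall u t, Derive (fun u => G u t) u = D u t)
  by (intros; apply is_derive_unique, HD).
replace (RInt (D 0) 0 1) with (RInt (fun t => Derive (fun u => G u t) 0) 0 1)
  by (apply RInt_ext; intros; apply E).
apply (is_derive_RInt_param (fun u t => G u t)).
- exists (mkposreal 1 Rlt_0_1). intros u _ t _. eexists; apply HD.
- intros t _. apply continuity_2d_pt_ext with (f := D).
  { intros; symmetry; apply E. }
  apply continuity_2d_pt_filterlim, HcD.
- exists (mkposreal 1 Rlt_0_1). intros u _.
  apply (ex_RInt_continuous (V := R_CompleteNormedModule)). intros; apply HcG.
Qed.

Lemma cont_scaled_pow (T : UniformSpace) (g : cyl -> R) k
  (a : T -> X) (b c : T -> R) z :
  (forall y, continuous g y) ->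
  continuous a z -> continuous b z -> continuous c z ->
  continuous (fun z => g (a z, b z) * c z ^ k) z.
Proof.
intros Hg Ha Hb Hc.
apply (continuous_mult (K := R_AbsRing)
  (fun z => g (a z, b z)) (fun z => c z ^ k)).
- apply (continuous_comp (fun z => (a z, b z) : cyl) g z); [|apply Hg].
  apply (continuous_pair T X R_UniformSpace); assumption.
- apply (continuous_comp c (fun r => r ^ k)); [exact Hc|].
  apply (ex_derive_continuous (K := R_AbsRing) (V := R_NormedModule)).
  auto_derive; exact I.
Qed.

Lemma cont_Rmult (T : UniformSpace) (a b : T -> R) z :
  continuous a z -> continuous b z -> continuous (fun z => a z * b z) z.
Proof. apply (continuous_mult (K := R_AbsRing)). Qed.

Lemma Ck_RInt n : forall k (g : cyl -> R), Ck n g ->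
  @Ck cyl n (fun y => RInt (fun t => g (fst y, t * snd y) * t ^ k) 0 1).
Proof.
assert (Hc : forall k (g : cyl -> R), (forall y, continuous g y) ->
  forall y, @continuous cyl R_UniformSpace
    (fun y => RInt (fun t => g (fst y, t * snd y) * t ^ k) 0 1) y).
{ intros k g Hg y.
  apply (continuous_RInt_param cyl
    (fun z => g (fst (fst z), snd z * snd (fst z)) * snd z ^ k)).
  intros z. apply (cont_scaled_pow (prod_UniformSpace cyl R_UniformSpace) g k
    (fun z => fst (fst z)) (fun z => snd z * snd (fst z)) (fun z => snd z));
    [exact Hg | | | apply cont_snd].
  - apply (continuous_comp fst fst); apply cont_fst.
  - apply cont_Rmult; [apply cont_snd|].
    apply (continuous_comp fst snd); [apply cont_fst | apply cont_snd]. }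
induction n; intros k g Hg.
{ split; [|exact I]. apply Hc. intros y; eapply Ck_cont; exact Hg. }
assert (Hg1 : Ck 1 g).
{ clear -Hg. revert g Hg. induction n; intros g Hg; [exact Hg|].
  apply IHn, Ck_pred, Hg. }
assert (Hgc : forall y, continuous g y) by (intros y; eapply Ck_cont; exact Hg).
assert (Hdc : forall i y, continuous (dir i g) y).
{ intros i y. eapply Ck_cont. apply Ck_dir_Ck, Hg. }
apply (Ck_step cyl) with (g := fun i y =>
  match i with
  | Some i => RInt (fun t => dir (X := cyl) (Some i) g (fst y, t * snd y) * t ^ k) 0 1
  | None => RInt (fun t => dir (X := cyl) None g (fst y, t * snd y) * t ^ (S k)) 0 1
  end).
- apply Hc, Hgc.
- intros [i|] [x j]; simpl fst; simpl snd.
  + change x with (fst (x, j)) at 2. rewrite <- (flow_0 X i (fst (x, j))).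
    apply (RInt_param_derive
      (fun u t => g (flow i u x, t * j) * t ^ k)
      (fun u t => dir (X := cyl) (Some i) g (flow i u x, t * j) * t ^ k)).
    * intros u t. apply (is_derive_ext (fun v => t ^ k * g (flow i v x, t * j))).
      { intros; apply Rmult_comm. }
      rewrite (Rmult_comm _ (t ^ k)). apply is_derive_scal.
      exact (flow_derive cyl g (Some i) (x, t * j) u Hg1).
    * intros u t. apply (cont_scaled_pow (prod_UniformSpace R_UniformSpace R_UniformSpace)
        (dir (X := cyl) (Some i) g) k
        (fun z => flow i (fst z) x) (fun z => snd z * j) (fun z => snd z));
        [apply Hdc | | | apply cont_snd].
      -- apply (continuous_comp_2 (fun z : R * R => fst z) (fun _ : R * R => x)
           (fun a b => flow i a b));
         [apply cont_fst | apply continuous_const | apply flow_cont].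
      -- apply cont_Rmult; [apply cont_snd | apply continuous_const].
    * intros u t. apply (cont_scaled_pow R_UniformSpace g k
        (fun _ => flow i u x) (fun z => z * j) (fun z => z));
        [exact Hgc | apply continuous_const | | apply continuous_id].
      apply cont_Rmult; [apply continuous_id | apply continuous_const].
  + replace (RInt (fun t => dir (X := cyl) None g (x, t * j) * t ^ S k) 0 1)
      with (RInt (fun t => dir (X := cyl) None g (x, t * (j + 0)) * t ^ S k) 0 1)
      by (now rewrite Rplus_0_r).
    apply (RInt_param_derive
      (fun u t => g (x, t * (j + u)) * t ^ k)
      (fun u t => dir (X := cyl) None g (x, t * (j + u)) * t ^ S k)).
    * intros u t.
      apply (is_derive_ext (fun v => t ^ k * g (flow (f := cyl) None (t * (j + v)) (x, 0)))).
      { intros v. simpl. rewrite Rplus_0_l. apply Rmult_comm. }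
      replace (dir (X := cyl) None g (x, t * (j + u)) * t ^ S k)
        with (t ^ k * (t * dir (X := cyl) None g (x, t * (j + u)))) by (simpl; ring).
      apply is_derive_scal.
      assert (H := flow_derive cyl g None (x, 0) (t * (j + u)) Hg1).
      simpl flow at 2 in H. rewrite Rplus_0_l in H.
      assert (Hs : is_derive (fun v => t * (j + v)) u t)
        by (auto_derive; [exact I | ring]).
      exact (is_derive_Rcomp (fun v => g (flow (f := cyl) None v (x, 0)))
               (fun v => t * (j + v)) u _ _ H Hs).
    * intros u t. apply (cont_scaled_pow (prod_UniformSpace R_UniformSpace R_UniformSpace)
        (dir (X := cyl) None g) (S k)
        (fun _ => x) (fun z => snd z * (j + fst z)) (fun z => snd z));
        [apply Hdc | apply continuous_const | | apply cont_snd].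
      apply cont_Rmult; [apply cont_snd|].
      apply (continuous_plus (V := R_NormedModule));
        [apply continuous_const | apply cont_fst].
    * intros u t. apply (cont_scaled_pow R_UniformSpace g k
        (fun _ => x) (fun z => z * (j + u)) (fun z => z));
        [exact Hgc | apply continuous_const | | apply continuous_id].
      apply cont_Rmult; [apply continuous_id | apply continuous_const].
- intros [i|].
  + exact (IHn k _ (Ck_dir_Ck cyl n g (Some i) Hg)).
  + exact (IHn (S k) _ (Ck_dir_Ck cyl n g None Hg)).
Qed.

Definition hadamard (f : X * R -> R) (f' : X * R -> R) (y : X * R) : R :=
  if Req_EM_T (snd y) 0 then f' (fst y, 0)
  else (f y - f (fst y, 0)) / snd y.

Lemma Ck_hadamard n (f : cyl -> R) : Ck (S n) f ->
  @Ck cyl n (hadamard f (dir (X := cyl) None f)).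
Proof.
intros Hf. generalize (Ck_RInt n 0 _ (Ck_dir_Ck cyl n f None Hf)).
apply (fun E => eq_ind_r (fun h => Ck n h -> Ck n _) (fun h => h) E).
apply functional_extensionality. intros [x j]. unfold hadamard; simpl fst; simpl snd.
assert (Hf1 : Ck 1 f).
{ clear -Hf. revert f Hf. induction n; intros f Hf; [exact Hf|].
  apply IHn, Ck_pred, Hf. }
assert (Hdc : forall y, continuous (dir (X := cyl) None f) y).
{ intros y. eapply Ck_cont. apply Ck_dir_Ck, Hf. }
destruct (Req_EM_T j 0) as [Hj|Hj].
- rewrite (RInt_ext _ (fun _ => dir (X := cyl) None f (x, 0))).
  + rewrite RInt_const. unfold scal; simpl; unfold mult; simpl. ring.
  + intros t _. rewrite Hj, Rmult_0_r. simpl; ring.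
- assert (H : is_RInt (fun t => j * dir (X := cyl) None f (x, t * j)) 0 1
                (minus (f (x, 1 * j)) (f (x, 0 * j)))).
  { apply (is_RInt_derive (V := R_CompleteNormedModule) (fun t => f (x, t * j))).
    - intros t _. apply (is_derive_ext (fun t => f (flow (f := cyl) None (t * j) (x, 0)))).
      { intros v. simpl. now rewrite Rplus_0_l. }
      assert (H := flow_derive cyl f None (x, 0) (t * j) Hf1).
      simpl flow at 2 in H. rewrite Rplus_0_l in H.
      assert (Hs : is_derive (fun v => v * j) t j)
        by (auto_derive; [exact I | ring]).
      exact (is_derive_Rcomp (fun v => f (flow (f := cyl) None v (x, 0)))
               (fun v => v * j) t _ _ H Hs).
    - intros t _. apply cont_Rmult; [apply continuous_const|].
      apply (continuous_comp (fun t : R => (x, t * j) : cyl) _ t); [|apply Hdc].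
      apply (continuous_pair R_UniformSpace X R_UniformSpace);
        [apply continuous_const|].
      apply cont_Rmult; [apply continuous_id | apply continuous_const]. }
  apply (is_RInt_scal (V := R_NormedModule) _ _ _ (/ j)) in H.
  apply (is_RInt_unique (V := R_CompleteNormedModule)) in H.
  rewrite Rmult_1_l, Rmult_0_l in H.
  transitivity (/ j * (f (x, j) - f (x, 0))).
  + etransitivity; [|exact H]. apply RInt_ext. intros t _.
    set (d := dir (X := cyl) None f (x, t * j)).
    change (d * 1 = / j * (j * d)). field. exact Hj.
  + unfold Rdiv. apply Rmult_comm.
Qed.
End Cylinder.

Definition prol {X : framed} (u : Cinf X) : Cinf (cyl X) :=
  MkCinf (X := cyl X) (fun y => u (fst y))
    (fun n => conj (Ck_fst X n _ (proj1 (fn_smooth u n)))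
                   (Ck_fst X n _ (proj2 (fn_smooth u n)))).

Definition iota {X : framed} (x : X) : cyl X := (x, 0).

Definition iota_star {X : framed} (f : Cinf (cyl X)) : Cinf X :=
  MkCinf (fun x => f (iota x))
    (fun n => conj (Ck_zero_section X n _ (proj1 (fn_smooth f n)))
                   (Ck_zero_section X n _ (proj2 (fn_smooth f n)))).

Definition fibre_coord (X : framed) : Cinf (cyl X) :=
  MkCinf (X := cyl X) (fun y => RtoC (snd y))
    (fun n => conj (Ck_snd X n) (Ck_const (cyl X) n 0)).

(** Hadamard's lemma: the quotient is [int_0^1 (d f / d J) (x, t J) dt], whence
    its smooth extension to [J = 0] takes the value [(d f / d J) (x, 0)]. *)
Definition h0_fun {X : framed} (f : Cinf (cyl X)) (y : cyl X) : C :=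
  if Req_EM_T (snd y) 0 then pd (X := cyl X) None f (iota (fst y))
  else ((f y - f (iota (fst y))) / RtoC (snd y))%C.

Lemma h0_smooth (X : framed) (f : Cinf (cyl X)) : smooth (h0_fun f).
Proof.
intros n. destruct (fn_smooth f (S n)) as [H1 H2].
apply Ck_hadamard in H1. apply Ck_hadamard in H2. split.
- revert H1. apply (fun E => eq_ind_r (fun h => Ck n h -> Ck n _) (fun h => h) E).
  apply functional_extensionality. intros [x j]. unfold hadamard, h0_fun, iota.
  simpl fst; simpl snd. destruct (Req_EM_T j 0) as [Hj|Hj]; [reflexivity|].
  unfold Re; simpl. field. exact Hj.
- revert H2. apply (fun E => eq_ind_r (fun h => Ck n h -> Ck n _) (fun h => h) E).
  apply functional_extensionality. intros [x j]. unfold hadamard, h0_fun, iota.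
  simpl fst; simpl snd. destruct (Req_EM_T j 0) as [Hj|Hj]; [reflexivity|].
  unfold Im; simpl. field. exact Hj.
Qed.

Definition h0 {X : framed} (f : Cinf (cyl X)) : Cinf (cyl X) :=
  MkCinf _ (h0_smooth X f).

Record circle := Circle { cval :> C; cval_norm : Cmod cval = 1 }.

Lemma circle_ext (z w : circle) : cval z = cval w -> z = w.
Proof.
destruct z as [z Hz], w as [w Hw]; simpl; intros ->. f_equal. apply proof_irrelevance.
Qed.

Definition circle_UniformSpace_mixin :=
  UniformSpace.Mixin circle (Circle 1 Cmod_1)
    (fun z e w => ball (cval z) e (cval w))
    (fun z e => ball_center (cval z) e)
    (fun z w e => ball_sym (cval z) (cval w) e)
    (fun z w v e1 e2 => ball_triangle (cval z) (cval w) (cval v) e1 e2).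
Canonical circle_UniformSpace :=
  UniformSpace.Pack circle circle_UniformSpace_mixin circle.

Definition expi (t : R) : C := (cos t, sin t).

Lemma expi_norm t : Cmod (expi t) = 1.
Proof.
unfold Cmod, expi; simpl fst; simpl snd.
transitivity (sqrt (Rsqr (sin t) + Rsqr (cos t))).
- f_equal. unfold Rsqr. ring.
- rewrite sin2_cos2. apply sqrt_1.
Qed.

Lemma rot_norm t (z : circle) : Cmod (z * expi t)%C = 1.
Proof. rewrite Cmod_mult, cval_norm, expi_norm. ring. Qed.

Definition rot (t : R) (z : circle) : circle := Circle _ (rot_norm t z).

Lemma rot_0 z : rot 0 z = z.
Proof.
apply circle_ext; simpl. unfold expi. rewrite cos_0, sin_0. apply Cmult_1_r.
Qed.

Lemma rot_add s t z : rot (s + t) z = rot s (rot t z).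
Proof.
apply circle_ext; simpl. unfold expi. rewrite cos_plus, sin_plus.
destruct (cval z) as [a b]. unfold Cmult; simpl. f_equal; ring.
Qed.

Lemma rot_cont t z :
  continuous (fun y : R * circle => rot (fst y) (snd y)) (t, z).
Proof.
enough (H : continuous (fun y : R * circle => cval (rot (fst y) (snd y))) (t, z)).
{ apply filterlim_locally. intros e.
  exact (proj1 (filterlim_locally _ _) H e). }
assert (Hv : continuous (fun y : R * circle => cval (snd y)) (t, z)).
{ apply (continuous_comp snd cval); [apply continuous_snd|].
  apply filterlim_locally. intros e. exists e. intros w Hw. exact Hw. }
assert (Hv1 : continuous (fun y : R * circle => fst (cval (snd y))) (t, z))
  by (apply (continuous_comp (fun y : R * circle => cval (snd y)) fst);
      [exact Hv | apply cont_fst]).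
assert (Hv2 : continuous (fun y : R * circle => snd (cval (snd y))) (t, z))
  by (apply (continuous_comp (fun y : R * circle => cval (snd y)) snd);
      [exact Hv | apply cont_snd]).
assert (Hc : continuous (fun y : R * circle => cos (fst y)) (t, z)).
{ apply (continuous_comp fst cos); [apply continuous_fst | apply continuous_cos]. }
assert (Hs : continuous (fun y : R * circle => sin (fst y)) (t, z)).
{ apply (continuous_comp fst sin); [apply continuous_fst | apply continuous_sin]. }
apply (continuous_pair _ R_UniformSpace R_UniformSpace).
- apply (continuous_minus (V := R_NormedModule)); apply cont_Rmult; assumption.
- apply (continuous_plus (V := R_NormedModule)); apply cont_Rmult; assumption.
Qed.

Inductive C_coord := c_phi | c_p | c_psi.

Definition C_flow (i : C_coord) (t : R) (x : circle * R * circle) :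
  circle * R * circle :=
  let '(z, q, w) := x in
  match i with
  | c_phi => (rot t z, q, w)
  | c_p => (z, q + t, w)
  | c_psi => (z, q, rot t w)
  end.

Lemma C_flow_0 i x : C_flow i 0 x = x.
Proof.
destruct x as [[z q] w], i; simpl; now rewrite ?rot_0, ?Rplus_0_r.
Qed.

Lemma C_flow_add i s t x : C_flow i (s + t) x = C_flow i s (C_flow i t x).
Proof.
destruct x as [[z q] w], i; simpl; rewrite ?rot_add; try reflexivity.
do 2 f_equal; ring.
Qed.

Definition C_space : UniformSpace :=
  prod_UniformSpace (prod_UniformSpace circle_UniformSpace R_UniformSpace)
    circle_UniformSpace.

Lemma C_flow_cont i t (x : C_space) :
  continuous (fun y : R * C_space => (C_flow i (fst y) (snd y) : C_space)) (t, x).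
Proof.
assert (H1 : continuous (fun y : R * C_space => fst (fst (snd y))) (t, x)).
{ apply (continuous_comp snd (fun x : C_space => fst (fst x))); [apply cont_snd|].
  apply (continuous_comp fst fst); apply cont_fst. }
assert (H2 : continuous (fun y : R * C_space => snd (fst (snd y))) (t, x)).
{ apply (continuous_comp snd (fun x : C_space => snd (fst x))); [apply cont_snd|].
  apply (continuous_comp fst snd); [apply cont_fst | apply cont_snd]. }
assert (H3 : continuous (fun y : R * C_space => snd (snd y)) (t, x)).
{ apply (continuous_comp snd (fun x : C_space => snd x)); apply cont_snd. }
assert (H0 : continuous (fun y : R * C_space => fst y) (t, x)) by apply cont_fst.
assert (Hr : forall h : R * C_space -> circle, continuous h (t, x) ->
  continuous (fun y => rot (fst y) (h y)) (t, x)).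
{ intros h Hh. apply (continuous_comp_2 (fun y : R * C_space => fst y) h rot);
    [exact H0 | exact Hh | apply rot_cont]. }
destruct i.
- apply continuous_ext with
    (f := fun y : R * C_space =>
      (rot (fst y) (fst (fst (snd y))), snd (fst (snd y)), snd (snd y)) : C_space).
  { now intros [s [[z q] w]]. }
  repeat apply continuous_pair; [exact (Hr _ H1) | exact H2 | exact H3].
- apply continuous_ext with
    (f := fun y : R * C_space =>
      (fst (fst (snd y)), snd (fst (snd y)) + fst y, snd (snd y)) : C_space).
  { now intros [s [[z q] w]]. }
  repeat apply continuous_pair; [exact H1 | | exact H3].
  exact (continuous_plus (V := R_NormedModule) _ _ _ H2 H0).
- apply continuous_ext with
    (f := fun y : R * C_space =>
      (fst (fst (snd y)), snd (fst (snd y)), rot (fst y) (snd (snd y))) : C_space).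
  { now intros [s [[z q] w]]. }
  repeat apply continuous_pair; [exact H1 | exact H2 | exact (Hr _ H3)].
Qed.

Definition Csurf : framed :=
  Framed C_space C_coord C_flow C_flow_0 C_flow_add C_flow_cont.

(** A point of [M] is [((z, p, w), J)], so [M] is literally the cylinder
    [C * R] and [iota] is [(z, p, w) |-> (z, p, w, 0)]. *)
Definition M : framed := cyl Csurf.

Definition J : Cinf M := fibre_coord Csurf.

Definition dphi (f : Cinf M) : Cinf M := pd (X := M) (Some c_phi) f.
Definition dp (f : Cinf M) : Cinf M := pd (X := M) (Some c_p) f.
Definition dpsi (f : Cinf M) : Cinf M := pd (X := M) (Some c_psi) f.
Definition dJ (f : Cinf M) : Cinf M := pd (X := M) None f.

(** The bracket of [omega = - dphi /\ dp + dpsi /\ dJ] for the convention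
    [{f, g} = omega (X_f, X_g)], [i_{X_f} omega = df]. *)
Definition poisson (f g : Cinf M) : Cinf M :=
  plus (minus (cinf_mult (dp f) (dphi g)) (cinf_mult (dphi f) (dp g)))
       (minus (cinf_mult (dpsi f) (dJ g)) (cinf_mult (dJ f) (dpsi g))).

Lemma Ck_p n : @Ck Csurf n (fun x => snd (fst x)).
Proof.
assert (Hc : forall x : Csurf, continuous (fun x : Csurf => snd (fst x)) x).
{ intros x. apply (continuous_comp fst snd); [apply cont_fst | apply cont_snd]. }
destruct n; [split; [exact Hc | exact I]|].
apply (Ck_step Csurf) with (g := fun i _ => match i with c_p => 1 | _ => 0 end).
- exact Hc.
- intros i [[z q] w]. destruct i.
  + exact (is_derive_cst q 0).
  + simpl. auto_derive; [exact I | reflexivity].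
  + exact (is_derive_cst q 0).
- intros i. destruct i; apply Ck_const.
Qed.

Definition p_C : Cinf Csurf :=
  MkCinf (X := Csurf) (fun x => RtoC (snd (fst x)))
    (fun n => conj (Ck_p n) (Ck_const Csurf n 0)).
Definition p_M : Cinf M := prol p_C.

(** [V[[lambda]]]: the coefficient of [lambda^n] of [f] is [f n]. *)
Definition fps (V : Type) := nat -> V.

Definition fps_const {V : AbelianMonoid} (v : V) : fps V :=
  fun n => match n with O => v | S _ => zero end.

Definition lam {V : AbelianMonoid} (f : fps V) : fps V :=
  fun n => match n with O => zero | S m => f m end.

(** Division by [lambda]; only meaningful for series without constant term
    (see [lam_div_lam]). *)
Definition div_lam {V : Type} (f : fps V) : fps V := fun n => f (S n).

Lemma lam_div_lam (V : AbelianMonoid) (f : fps V) :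
  f O = zero -> lam (div_lam f) = f.
Proof.
intros H. apply functional_extensionality. intros [|n];
  [exact (eq_sym H) | reflexivity].
Qed.

(** [exp (lambda D)] *)
Definition exp_lam {V : ModuleSpace C_Ring} (D : V -> V) (f : fps V) : fps V :=
  fun n => sum_n (fun k =>
    scal (RtoC (/ INR (fact k)) : C_Ring) (Nat.iter k D (f (n - k)%nat))) n.

(** [(id - lambda A)^{-1}] as the geometric series [sum_k (lambda A)^k]; the
    terms with [k > n] do not contribute to order [n]. *)
Definition inv_id_sub_lam {V : AbelianMonoid} (A : fps V -> fps V) (f : fps V) :
  fps V :=
  fun n => sum_n (fun k => Nat.iter k (fun g => lam (A g)) f n) n.

Definition linear_on {V : ModuleSpace C_Ring} (W : V -> Prop) (E : V -> V) :=
  (forall v w, W v -> W w -> E (plus v w) = plus (E v) (E w)) /\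
  (forall (c : C_Ring) w, W w -> E (scal c w) = scal c (E w)).

(** [bW = E (W[[lambda]])] for [E = sum_r lambda^r E_r]; such an image is
    automatically a [C[[lambda]]]-submodule. A linear map [W -> V] is given by
    its values on [W]; those of [E r] outside [W] are irrelevant. *)
Definition is_deformation {V : ModuleSpace C_Ring}
    (W : V -> Prop) (bW : fps V -> Prop) : Prop :=
  exists E : nat -> V -> V,
    (forall r, linear_on W (E r)) /\
    (forall w, W w -> E O w = w) /\
    (forall v : fps V, bW v <->
       exists w : fps V, (forall n, W (w n)) /\
         v = fun n => sum_n (fun r => E r (w (n - r)%nat)) n).

Section QuantumReduction.
Variable st : fps (Cinf M) -> fps (Cinf M) -> fps (Cinf M).

Definition rho_M (f : fps (Cinf M)) : fps (Cinf M) := fun n =>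
  scal (/ Ci : C_Ring)%C
    (div_lam (fun k => minus (st (fps_const J) f k) (st f (fps_const J) k)) n).

Definition B1 (f : fps (Cinf M)) : fps (Cinf M) :=
  div_lam (fun k => minus (cinf_mult J (f k)) (st f (fps_const J) k)).

Definition q_iota_star (f : fps (Cinf M)) : fps (Cinf Csurf) := fun n =>
  iota_star (inv_id_sub_lam (fun g => B1 (fun k => h0 (g k))) f n).

Definition rho_C (u : fps (Cinf Csurf)) : fps (Cinf Csurf) :=
  q_iota_star (rho_M (fun k => prol (u k))).

Definition classical_invariant (u : Cinf Csurf) : Prop :=
  pd (X := Csurf) c_psi u = zero.

Definition quantum_invariant (u : fps (Cinf Csurf)) : Prop :=
  rho_C u = fun _ => zero.

Definition consistent_quantum_reduction : Prop :=
  is_deformation classical_invariant quantum_invariant.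
End QuantumReduction.

(** [mu o (d/dphi (x) d/dp + d/dJ (x) d/dpsi)^r (f (x) g)] *)
Fixpoint bidiff (r : nat) (f g : Cinf M) : Cinf M :=
  match r with
  | O => cinf_mult f g
  | S r => plus (bidiff r (dphi f) (dp g)) (bidiff r (dJ f) (dpsi g))
  end.

Definition star_coef (r : nat) (f g : Cinf M) : Cinf M :=
  scal ((/ Ci) ^ r * RtoC (/ INR (fact r)) : C_Ring)%C (bidiff r f g).

Definition star (f g : fps (Cinf M)) : fps (Cinf M) := fun n =>
  sum_n (fun r => sum_n (fun a =>
    star_coef r (f a) (g (n - r - a)%nat)) (n - r)) n.

Definition p_dJ (f : Cinf M) : Cinf M := cinf_mult p_M (dJ f).

Definition Sop : fps (Cinf M) -> fps (Cinf M) := exp_lam p_dJ.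
Definition Sop_inv : fps (Cinf M) -> fps (Cinf M) :=
  exp_lam (fun f => opp (p_dJ f)).

Definition star_t (f g : fps (Cinf M)) : fps (Cinf M) :=
  Sop (star (Sop_inv f) (Sop_inv g)).

Definition depends_only_on_p (u : fps (Cinf Csurf)) : Prop :=
  exists v : nat -> R -> C, forall n z q w, u n (z, q, w) = v n q.

Lemma fps_sum_zero (V : AbelianMonoid) (u : nat -> V) n :
  (forall k, (k <= n)%nat -> u k = zero) -> sum_n u n = zero.
Proof.
intros H. induction n as [|n IHn].
- rewrite sum_O. apply H; lia.
- rewrite sum_Sn, IHn, H by (intros; try apply H; lia). apply plus_zero_r.
Qed.

Lemma fps_sum_head (V : AbelianMonoid) (u : nat -> V) n :
  (forall k, (k < n)%nat -> u (S k) = zero) -> sum_n u n = u O.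
Proof.
intros H. induction n as [|n IHn].
- apply sum_O.
- rewrite sum_Sn, IHn, H by (intros; try apply H; lia). apply plus_zero_r.
Qed.

Lemma fps_sum_last (V : AbelianMonoid) (u : nat -> V) n :
  (forall k, (k < n)%nat -> u k = zero) -> sum_n u n = u n.
Proof.
destruct n as [|n]; intros H; [apply sum_O|].
rewrite sum_Sn, fps_sum_zero by (intros; apply H; lia). apply plus_zero_l.
Qed.

Lemma fps_sum_triangle (V : AbelianMonoid) (F : nat -> nat -> V) n :
  sum_n (fun k => sum_n (F k) (n - k)) n =
  sum_n (fun m => sum_n (fun k => F k (m - k)%nat) m) n.
Proof.
induction n as [|n IHn]; [reflexivity|].
rewrite !sum_Sn, <- IHn, Nat.sub_diag, sum_O, plus_assoc, <- sum_n_plus.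
f_equal. apply sum_n_ext_loc. intros k Hk.
replace (S n - k)%nat with (S (n - k)) by lia. now rewrite sum_Sn.
Qed.

(** [id - lambda A] is invertible as soon as [A] is additive and compatible
    with truncation of power series. *)
Lemma inv_id_sub_lam_spec (V : AbelianGroup) (A : fps V -> fps V) :
  (forall f g, A (fun n => plus (f n) (g n)) = fun n => plus (A f n) (A g n)) ->
  (forall f g n, (forall k, (k <= n)%nat -> f k = g k) -> A f n = A g n) ->
  forall f g : fps V,
  (fun n => minus (g n) (lam (A g) n)) = f <-> g = inv_id_sub_lam A f.
Proof.
intros Hadd Hc.
assert (Hlc : forall f g n, (forall k, (k < n)%nat -> f k = g k) ->
  lam (A f) n = lam (A g) n).
{ intros f g [|n] H; [reflexivity|]. apply Hc. intros; apply H; lia. }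
assert (Hladd : forall f g n,
  lam (A (fun n => plus (f n) (g n))) n = plus (lam (A f) n) (lam (A g) n)).
{ intros f g [|n]; simpl; [now rewrite plus_zero_r | now rewrite Hadd]. }
set (T := fun g => lam (A g)).
assert (Hz : forall n, T (fun _ => zero) n = zero).
{ intros n. apply (plus_reg_l (T (fun _ => zero) n)).
  transitivity (T (fun _ => zero) n); [|symmetry; apply plus_zero_r].
  etransitivity; [symmetry; exact (Hladd (fun _ => zero) (fun _ => zero) n)|].
  apply Hlc. intros; apply plus_zero_r. }
assert (Hlow : forall f k n, (n < k)%nat -> Nat.iter k T f n = zero).
{ intros f. induction k as [|k IHk]; intros n Hn; [lia|]. simpl.
  rewrite <- (Hz n). apply Hlc. intros j Hj. apply IHk; lia. }
assert (Hsum : forall f m n,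
  T (fun j => sum_n (fun k => Nat.iter k T f j) m) n =
  sum_n (fun k => Nat.iter (S k) T f n) m).
{ intros f. induction m as [|m IHm]; intros n.
  - rewrite sum_O. apply Hlc. intros; apply sum_O.
  - rewrite sum_Sn, <- IHm. unfold T at 1. etransitivity; [|apply Hladd].
    apply Hlc. intros; apply sum_Sn. }
assert (Htr : forall f m n, (n <= m)%nat ->
  inv_id_sub_lam A f n = sum_n (fun k => Nat.iter k T f n) m).
{ intros f m n Hm. induction Hm as [|m Hm IHm]; [reflexivity|].
  rewrite sum_Sn, <- IHm, Hlow by lia. now rewrite plus_zero_r. }
assert (Hinv : forall f n, inv_id_sub_lam A f n =
  plus (f n) (T (inv_id_sub_lam A f) n)).
{ intros f n.
  replace (T (inv_id_sub_lam A f) n)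
    with (T (fun j => sum_n (fun k => Nat.iter k T f j) n) n)
    by (apply Hlc; intros; symmetry; apply Htr; lia).
  rewrite Hsum, (Htr f (S n) n) by lia.
  unfold sum_n. rewrite sum_Sn_m by lia. f_equal. now rewrite <- sum_n_m_S. }
intros f g. split.
- intros <-. apply functional_extensionality. intros n.
  induction n as [n IHn] using lt_wf_ind.
  transitivity (plus (minus (g n) (lam (A g) n)) (lam (A g) n)).
  + unfold minus. now rewrite <- plus_assoc, plus_opp_l, plus_zero_r.
  + symmetry. rewrite Hinv. apply (f_equal2 plus); [reflexivity|].
    symmetry. apply Hlc. exact IHn.
- intros ->. apply functional_extensionality. intros n.
  transitivity (minus (plus (f n) (T (inv_id_sub_lam A f) n))
                      (T (inv_id_sub_lam A f) n)).
  + now rewrite <- Hinv.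
  + generalize (T (inv_id_sub_lam A f) n) (f n). clear. intros a b.
    unfold minus. rewrite <- plus_assoc.
    transitivity (plus b (@zero V)); [|apply plus_zero_r].
    apply (f_equal (plus b)). exact (plus_opp_r a).
Qed.

Lemma exp_coef_sum m :
  sum_f_R0 (fun k => / INR (fact k) * (/ INR (fact (m - k)) * (-1) ^ (m - k))) m
  = match m with O => 1 | S _ => 0 end.
Proof.
transitivity (/ INR (fact m) * (1 + -1) ^ m).
- rewrite binomial, scal_sum. apply sum_eq. intros k Hk. unfold Binomial.C.
  rewrite pow1. field. repeat split; apply INR_fact_neq_0.
- destruct m; simpl; [field | ring].
Qed.

Lemma sum_n_lin (V : ModuleSpace C_Ring) (D : V -> V) (u : nat -> V) n :
  (forall v w, D (plus v w) = plus (D v) (D w)) ->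
  D (sum_n u n) = sum_n (fun k => D (u k)) n.
Proof.
intros H. induction n as [|n IHn]; [now rewrite !sum_O|].
now rewrite !sum_Sn, H, IHn.
Qed.

Lemma sum_n_scal_C (V : ModuleSpace C_Ring) (a : nat -> R) (v : V) n :
  sum_n (fun k => scal (RtoC (a k) : C_Ring) v) n =
  scal (RtoC (sum_f_R0 a n) : C_Ring) v.
Proof.
induction n as [|n IHn]; [apply sum_O|].
rewrite sum_Sn, IHn. simpl. rewrite RtoC_plus. symmetry.
exact (scal_distr_r (RtoC (sum_f_R0 a n) : C_Ring) (RtoC (a (S n)) : C_Ring) v).
Qed.

Lemma iter_linear (V : ModuleSpace C_Ring) (D : V -> V) k :
  linear_on (fun _ => True) D -> linear_on (fun _ => True) (Nat.iter k D).
Proof.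
intros [H1 H2]. induction k as [|k [I1 I2]]; [split; reflexivity|].
split; intros; simpl.
- rewrite I1, H1; trivial.
- rewrite I2, H2; trivial.
Qed.

Lemma iter_opp (V : ModuleSpace C_Ring) (D : V -> V) k v :
  linear_on (fun _ => True) D ->
  Nat.iter k (fun w => opp (D w)) v = scal (RtoC ((-1) ^ k) : C_Ring) (Nat.iter k D v).
Proof.
intros [H1 H2]. induction k as [|k IHk].
- symmetry. exact (scal_one (K := C_Ring) v).
- simpl Nat.iter. rewrite IHk, H2 by trivial.
  rewrite <- scal_opp_one, scal_assoc. apply (f_equal2 scal); [|reflexivity].
  simpl pow. rewrite RtoC_mult. unfold mult, opp, one; simpl.
  change (RtoC (-1)) with (RtoC (- (1))). rewrite RtoC_opp. ring.
Qed.

Lemma exp_lam_opp (V : ModuleSpace C_Ring) (D : V -> V) (f : fps V) :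
  linear_on (fun _ => True) D ->
  exp_lam D (exp_lam (fun v => opp (D v)) f) = f.
Proof.
intros HD. apply functional_extensionality. intros n.
pose (a k := / INR (fact k)).
pose (F k l := scal (RtoC (a k * (a l * (-1) ^ l)) : C_Ring)
                 (Nat.iter (k + l) D (f (n - (k + l))%nat))).
transitivity (sum_n (fun k => sum_n (F k) (n - k)) n).
- unfold exp_lam. apply sum_n_ext_loc. intros k Hk.
  destruct (iter_linear V D k HD) as [I1 I2].
  rewrite (sum_n_lin V (Nat.iter k D)) by (intros; apply I1; trivial).
  rewrite <- (sum_n_scal_l (K := C_Ring)). apply sum_n_ext. intros l.
  rewrite I2, iter_opp by trivial. rewrite I2 by trivial. rewrite !scal_assoc.
  unfold F. rewrite Nat.iter_add. replace (n - k - l)%nat with (n - (k + l))%nat by lia.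
  apply (f_equal2 scal); [|reflexivity]. rewrite !RtoC_mult. symmetry; apply Cmult_assoc.
- rewrite fps_sum_triangle.
  transitivity (sum_n (fun m => scal (RtoC (match m with O => 1 | S _ => 0 end) : C_Ring)
                  (Nat.iter m D (f (n - m)%nat))) n).
  + apply sum_n_ext_loc. intros m Hm. rewrite <- exp_coef_sum, <- sum_n_scal_C.
    apply sum_n_ext_loc. intros k Hk. unfold F. now replace (k + (m - k))%nat with m by lia.
  + rewrite fps_sum_head.
    * simpl. rewrite Nat.sub_0_r. exact (scal_one (K := C_Ring) (f n)).
    * intros k _. exact (scal_zero_l (K := C_Ring) _).
Qed.

Lemma ex_pd (X : framed) (i : coord X) (f : Cinf X) x :
  ex_derive (fun t => fst (f (flow i t x))) 0 /\
  ex_derive (fun t => snd (f (flow i t x))) 0.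
Proof.
destruct (fn_smooth f 1%nat) as [H1 H2]. split.
- eexists. exact (Ck_dir X 0 _ i x H1).
- eexists. exact (Ck_dir X 0 _ i x H2).
Qed.

Lemma pd_linear (X : framed) (i : coord X) : linear_on (fun _ => True) (pd i).
Proof.
split.
- intros v w _ _. apply Cinf_ext. intros x.
  destruct (ex_pd X i v x) as [v1 v2], (ex_pd X i w x) as [w1 w2].
  apply injective_projections.
  + exact (Derive_plus _ _ _ v1 w1).
  + exact (Derive_plus _ _ _ v2 w2).
- intros [c d] v _. apply Cinf_ext. intros x.
  destruct (ex_pd X i v x) as [v1 v2].
  apply injective_projections.
  + etransitivity; [exact (Derive_minus _ _ _ (ex_derive_scal _ c _ v1)
                            (ex_derive_scal _ d _ v2))|].
    exact (f_equal2 Rminus (Derive_scal _ c _) (Derive_scal _ d _)).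
  + etransitivity; [exact (Derive_plus _ _ _ (ex_derive_scal _ c _ v2)
                            (ex_derive_scal _ d _ v1))|].
    exact (f_equal2 Rplus (Derive_scal _ c _) (Derive_scal _ d _)).
Qed.

Lemma p_dJ_linear : linear_on (fun _ => True) p_dJ.
Proof.
destruct (pd_linear M None) as [H1 H2]. unfold p_dJ, dJ. split.
- intros v w _ _. rewrite H1 by trivial. apply Cinf_ext; intros x; simpl; ring.
- intros c v _. rewrite H2 by trivial. apply Cinf_ext; intros x; simpl; ring.
Qed.

Lemma Sop_Sop_inv f : Sop (Sop_inv f) = f.
Proof. apply exp_lam_opp, p_dJ_linear. Qed.

Lemma Sop_inv_Sop f : Sop_inv (Sop f) = f.
Proof.
unfold Sop_inv, Sop.
replace (exp_lam p_dJ f) with (exp_lam (fun v => opp (opp (p_dJ v))) f).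
- apply (exp_lam_opp _ (fun v => opp (p_dJ v))).
  destruct p_dJ_linear as [H1 H2]. split.
  + intros v w _ _. rewrite H1 by trivial. apply Cinf_ext; intros x; simpl; ring.
  + intros c v _. rewrite H2 by trivial. apply Cinf_ext; intros x; simpl; ring.
- f_equal. apply functional_extensionality; intros v.
  apply Cinf_ext; intros x; simpl; ring.
Qed.

Lemma linear_zero (V : ModuleSpace C_Ring) (D : V -> V) :
  linear_on (fun _ => True) D -> D zero = zero.
Proof.
intros [_ H]. rewrite <- (scal_zero_l (K := C_Ring) (@zero V)) at 1.
rewrite H by trivial. exact (scal_zero_l (K := C_Ring) _).
Qed.

Lemma exp_lam_plus (V : ModuleSpace C_Ring) (D : V -> V) (f g : fps V) :
  linear_on (fun _ => True) D ->
  exp_lam D (fun n => plus (f n) (g n)) =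
  fun n => plus (exp_lam D f n) (exp_lam D g n).
Proof.
intros HD. apply functional_extensionality. intros n. unfold exp_lam.
rewrite <- sum_n_plus. apply sum_n_ext. intros k.
rewrite (proj1 (iter_linear V D k HD)) by trivial.
exact (scal_distr_l (K := C_Ring) _ _ _).
Qed.

Lemma exp_lam_low (V : ModuleSpace C_Ring) (D : V -> V) (f : fps V) m :
  linear_on (fun _ => True) D -> (forall k, (k < m)%nat -> f k = zero) ->
  (forall k, (k < m)%nat -> exp_lam D f k = zero) /\ exp_lam D f m = f m.
Proof.
intros HD Hf.
assert (Hz : forall j k, (k < m)%nat ->
  scal (RtoC (/ INR (fact j)) : C_Ring) (Nat.iter j D (f k)) = zero).
{ intros j k Hk. rewrite Hf by exact Hk.
  rewrite (linear_zero V _ (iter_linear V D j HD)).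
  exact (scal_zero_r (K := C_Ring) _). }
split.
- intros k Hk. apply fps_sum_zero. intros j Hj. apply Hz. lia.
- unfold exp_lam. rewrite fps_sum_head by (intros; apply Hz; lia).
  simpl. rewrite Nat.sub_0_r, Rinv_1. exact (scal_one (K := C_Ring) (f m)).
Qed.

Lemma bidiff_plus r : forall f f' g,
  bidiff r (plus f f') g = plus (bidiff r f g) (bidiff r f' g).
Proof.
induction r as [|r IHr]; intros f f' g.
- apply Cinf_ext; intros x; simpl; ring.
- simpl. unfold dphi, dJ. rewrite !(proj1 (pd_linear M _)) by trivial.
  rewrite !IHr. apply Cinf_ext; intros x; simpl; ring.
Qed.

Lemma star_coef_plus r f f' g :
  star_coef r (plus f f') g = plus (star_coef r f g) (star_coef r f' g).
Proof.
unfold star_coef. rewrite bidiff_plus. exact (scal_distr_l (K := C_Ring) _ _ _).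
Qed.

Lemma star_coef_zero r g : star_coef r zero g = zero.
Proof.
apply (plus_reg_l (star_coef r zero g)). rewrite <- star_coef_plus.
now rewrite !plus_zero_r.
Qed.

Lemma star_plus f f' g :
  star (fun n => plus (f n) (f' n)) g = fun n => plus (star f g n) (star f' g n).
Proof.
apply functional_extensionality. intros n. unfold star.
rewrite <- sum_n_plus. apply sum_n_ext. intros r.
rewrite <- sum_n_plus. apply sum_n_ext. intros a. apply star_coef_plus.
Qed.

Lemma star_low f g m : (forall k, (k < m)%nat -> f k = zero) ->
  (forall k, (k < m)%nat -> star f g k = zero) /\
  star f g m = cinf_mult (f m) (g O).
Proof.
intros Hf. split.
- intros k Hk. apply fps_sum_zero. intros r Hr. apply fps_sum_zero. intros a Ha.
  rewrite Hf by lia. apply star_coef_zero.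
- unfold star. rewrite fps_sum_head.
  + rewrite Nat.sub_0_r, fps_sum_last.
    * rewrite Nat.sub_diag. unfold star_coef. simpl. rewrite Rinv_1.
      apply Cinf_ext; intros x; simpl; ring.
    * intros a Ha. rewrite Hf by lia. apply star_coef_zero.
  + intros r Hr. apply fps_sum_zero. intros a Ha.
    rewrite Hf by lia. apply star_coef_zero.
Qed.

Lemma opp_p_dJ_linear : linear_on (fun _ => True) (fun f => opp (p_dJ f)).
Proof.
destruct p_dJ_linear as [H1 H2]. split.
- intros v w _ _. rewrite H1 by trivial. apply Cinf_ext; intros x; simpl; ring.
- intros c v _. rewrite H2 by trivial. apply Cinf_ext; intros x; simpl; ring.
Qed.

Lemma star_t_plus f f' g :
  star_t (fun n => plus (f n) (f' n)) g =
  fun n => plus (star_t f g n) (star_t f' g n).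
Proof.
unfold star_t, Sop_inv.
rewrite exp_lam_plus by exact opp_p_dJ_linear.
rewrite star_plus. exact (exp_lam_plus _ _ _ _ p_dJ_linear).
Qed.

Lemma star_t_low f g m : (forall k, (k < m)%nat -> f k = zero) ->
  (forall k, (k < m)%nat -> star_t f g k = zero) /\
  star_t f g m = cinf_mult (f m) (g O).
Proof.
intros Hf. unfold star_t.
destruct (exp_lam_low _ _ f m opp_p_dJ_linear Hf) as [H1 H1'].
destruct (star_low (Sop_inv f) (Sop_inv g) m H1) as [H2 H2'].
destruct (exp_lam_low _ _ _ m p_dJ_linear H2) as [H3 H3'].
split; [exact H3|]. etransitivity; [exact H3'|]. rewrite H2'.
apply (f_equal2 cinf_mult); [exact H1'|].
apply (exp_lam_low _ _ g 0 opp_p_dJ_linear). intros; lia.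
Qed.

Lemma star_t_0 f g : star_t f g O = cinf_mult (f O) (g O).
Proof. apply star_t_low. intros; lia. Qed.

Lemma commutator_div_lam f :
  lam (div_lam (fun k => minus (star_t (fps_const J) f k)
                               (star_t f (fps_const J) k))) =
  fun k => minus (star_t (fps_const J) f k) (star_t f (fps_const J) k).
Proof.
apply lam_div_lam. rewrite !star_t_0. apply Cinf_ext; intros x; simpl; ring.
Qed.

Lemma B1_div_lam f :
  lam (B1 star_t f) =
  fun k => minus (cinf_mult J (f k)) (star_t f (fps_const J) k).
Proof.
apply lam_div_lam. rewrite star_t_0. apply Cinf_ext; intros x; simpl; ring.
Qed.

Lemma h0_plus (X : framed) (f g : Cinf (cyl X)) :
  h0 (plus f g) = plus (h0 f) (h0 g).
Proof.
apply Cinf_ext. intros y. simpl. unfold h0_fun.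
destruct (Req_EM_T (snd y) 0) as [Hy|Hy].
- rewrite (proj1 (pd_linear (cyl X) None)) by trivial. reflexivity.
- simpl. unfold Cdiv. ring.
Qed.

Lemma B1_h0_inverse (f g : fps (Cinf M)) :
  (fun n => minus (g n) (lam (B1 star_t (fun k => h0 (g k))) n)) = f <->
  g = inv_id_sub_lam (fun g => B1 star_t (fun k => h0 (g k))) f.
Proof.
assert (Hadd : forall f g : fps (Cinf M),
  B1 star_t (fun n => plus (f n) (g n)) =
  fun n => plus (B1 star_t f n) (B1 star_t g n)).
{ clear. intros f g. apply functional_extensionality. intros n.
  unfold B1, div_lam. rewrite star_t_plus. apply Cinf_ext; intros x; simpl; ring. }
apply (inv_id_sub_lam_spec _ (fun g => B1 star_t (fun k => h0 (g k)))).
- clear f g. intros f g.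
  etransitivity; [|exact (Hadd (fun k => h0 (f k)) (fun k => h0 (g k)))].
  apply (f_equal (B1 star_t)).
  apply functional_extensionality. intros n. apply h0_plus.
- clear f g. intros f g n H.
  set (d := fun k => minus (h0 (f k)) (h0 (g k))).
  replace (fun k => h0 (f k)) with (fun k => plus (d k) (h0 (g k))).
  2:{ apply functional_extensionality. intros k. unfold d.
      apply Cinf_ext; intros x; simpl; ring. }
  rewrite Hadd.
  assert (Hd : forall k, (k < S n)%nat -> d k = zero).
  { intros k Hk. unfold d. rewrite H by lia. apply Cinf_ext; intros x; simpl; ring. }
  replace (B1 star_t d n) with (@zero (Cinf_AbelianMonoid M)).
  + apply plus_zero_l.
  + unfold B1, div_lam. rewrite (proj2 (star_t_low d (fps_const J) (S n) Hd)).
    apply Cinf_ext; intros x; simpl; ring.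
Qed.

Lemma pd_real (X : framed) (i : coord X) (f : Cinf X) x (h : R -> R) (d : R) :
  (forall t, f (flow i t x) = RtoC (h t)) -> is_derive h 0 d ->
  pd i f x = RtoC d.
Proof.
intros H Hd. apply injective_projections; simpl; unfold dir.
- apply is_derive_unique. apply is_derive_ext with (f := h); [|exact Hd].
  intros t. now rewrite H.
- apply is_derive_unique. apply is_derive_ext with (f := fun _ => 0);
    [|apply is_derive_cst].
  intros t. now rewrite H.
Qed.

Lemma poisson_J f : poisson J f = opp (dpsi f).
Proof.
apply Cinf_ext. intros [[[z q] w] j]. unfold poisson, dphi, dp, dJ. simpl.
assert (H : forall i : C_coord, pd (X := M) (Some i) J (z, q, w, j) = RtoC 0).
{ intros i. apply pd_real with (h := fun _ => j); [|apply is_derive_cst].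
  reflexivity. }
assert (Hn : pd (X := M) None J (z, q, w, j) = RtoC 1).
{ apply pd_real with (h := fun t => j + t); [reflexivity|].
  auto_derive; [exact I | ring]. }
simpl in H, Hn. rewrite Hn, (H c_phi), (H c_p), (H c_psi). ring.
Qed.

Lemma poisson_p f : poisson p_M f = dphi f.
Proof.
apply Cinf_ext. intros [[[z q] w] j]. unfold poisson, dphi, dp, dJ. simpl.
assert (H1 : pd (X := M) (Some c_phi) p_M (z, q, w, j) = RtoC 0)
  by (apply pd_real with (h := fun _ => q); [reflexivity | apply is_derive_cst]).
assert (H2 : pd (X := M) (Some c_psi) p_M (z, q, w, j) = RtoC 0)
  by (apply pd_real with (h := fun _ => q); [reflexivity | apply is_derive_cst]).
assert (H3 : pd (X := M) None p_M (z, q, w, j) = RtoC 0)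
  by (apply pd_real with (h := fun _ => q); [reflexivity | apply is_derive_cst]).
assert (Hn : pd (X := M) (Some c_p) p_M (z, q, w, j) = RtoC 1).
{ apply pd_real with (h := fun t => q + t); [reflexivity|].
  auto_derive; [exact I | ring]. }
simpl in H1, H2, H3, Hn. rewrite H1, H2, H3, Hn. ring.
Qed.

Lemma exp_lam_1 (V : ModuleSpace C_Ring) (D : V -> V) (f : fps V) :
  exp_lam D f 1%nat = plus (f 1%nat) (D (f O)).
Proof.
unfold exp_lam. rewrite sum_Sn, sum_O. simpl. rewrite Rinv_1.
apply (f_equal2 plus); exact (scal_one (K := C_Ring) _).
Qed.

(** [f *~ g - g *~ f = i lambda {f, g} + O(lambda^2)]. *)
Lemma star_t_commutator f g :
  minus (star_t (fps_const f) (fps_const g) 1%nat)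
        (star_t (fps_const g) (fps_const f) 1%nat) =
  scal (Ci : C_Ring) (poisson f g).
Proof.
assert (H0 : forall h, Sop_inv (fps_const h) O = h).
{ intros h. apply (exp_lam_low _ _ (fps_const h) 0 opp_p_dJ_linear). intros; lia. }
assert (H1 : forall h, Sop_inv (fps_const h) 1%nat = opp (p_dJ h)).
{ intros h. unfold Sop_inv. rewrite exp_lam_1. apply plus_zero_l. }
assert (Hs : forall a b, star a b 1%nat =
  plus (plus (cinf_mult (a O) (b 1%nat)) (cinf_mult (a 1%nat) (b O)))
       (star_coef 1 (a O) (b O))).
{ intros a b. unfold star. rewrite sum_Sn, sum_O, Nat.sub_0_r, Nat.sub_diag.
  rewrite sum_Sn, !sum_O. unfold star_coef at 1 2. simpl. rewrite Rinv_1.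
  apply Cinf_ext; intros x; simpl; ring. }
assert (HS : forall a b, star_t (fps_const a) (fps_const b) 1%nat =
  plus (star (Sop_inv (fps_const a)) (Sop_inv (fps_const b)) 1%nat)
       (p_dJ (cinf_mult a b))).
{ intros a b. unfold star_t, Sop. rewrite exp_lam_1.
  rewrite (proj2 (star_low (Sop_inv (fps_const a)) (Sop_inv (fps_const b)) 0
    (fun k Hk => False_ind _ (Nat.nlt_0_r k Hk)))).
  now rewrite !H0. }
rewrite !HS, !Hs, !H0, !H1.
replace (cinf_mult g f) with (cinf_mult f g) by (apply Cinf_ext; intros x; simpl; ring).
assert (Hi : (/ Ci)%C = (- Ci)%C)
  by (apply injective_projections; simpl; field).
unfold star_coef. simpl. rewrite Hi, Rinv_1.
apply Cinf_ext; intros x. unfold poisson. simpl. ring.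
Qed.

(* Main.v *)
Require Import Defs.
From Stdlib Require Import Reals Factorial Lra Lia FunctionalExtensionality.
From Coquelicot Require Import Coquelicot.

(** With [S^{-1} J = J - lambda p] and [S^{-1} (prol u) = prol u], all star products
    with [J] of series pulled back from [C] terminate after the first bidifferential
    term:
      [J *~ prol u = J prol u - i lambda prol (d_psi u)],
      [prol u *~ J = J prol u + i lambda^2 prol (d_phi u)].
    As [h0 (prol u) = 0], the quantum restriction of [prol v] is [v], which gives
    the formula for [rho_C]. An invariant series satisfies [d_psi u_0 = 0] and
    [d_psi u_(n+1) = - d_phi u_n]. Inductively, the right-hand side does not depend
    on [psi], so it vanishes by periodicity in [psi]; hence no [u_n] depends on
    [phi] or [psi]. A deformation would contain a series with leading coefficient
    the classical invariant [z], which is not a function of [p]. *)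

(** * Derivatives of [J], [p] and functions pulled back from [Csurf] *)

Lemma pd_const (X : framed) (i : coord X) c : pd i (cinf_const c) = zero.
Proof.
apply Cinf_ext; intros x; apply injective_projections; exact (Derive_const _ _).
Qed.

Lemma pd_zero (X : framed) (i : coord X) : pd i (@zero (Cinf_AbelianMonoid X)) = zero.
Proof. apply pd_const. Qed.

Lemma pd_mult (X : framed) (i : coord X) (f g : Cinf X) :
  pd i (cinf_mult f g) = plus (cinf_mult (pd i f) g) (cinf_mult f (pd i g)).
Proof.
apply Cinf_ext; intros x.
destruct (ex_pd X i f x) as [f1 f2], (ex_pd X i g x) as [g1 g2].
assert (E : flow i 0 x = x) by apply flow_0.
apply injective_projections.
- etransitivity; [exact (Derive_minus _ _ _ (ex_derive_mult _ _ _ f1 g1)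
                          (ex_derive_mult _ _ _ f2 g2))|].
  etransitivity; [exact (f_equal2 Rminus (Derive_mult _ _ _ f1 g1)
                          (Derive_mult _ _ _ f2 g2))|].
  cbv beta. rewrite E. simpl. unfold dir, Re, Im. ring.
- etransitivity; [exact (Derive_plus _ _ _ (ex_derive_mult _ _ _ f1 g2)
                          (ex_derive_mult _ _ _ f2 g1))|].
  etransitivity; [exact (f_equal2 Rplus (Derive_mult _ _ _ f1 g2)
                          (Derive_mult _ _ _ f2 g1))|].
  cbv beta. rewrite E. simpl. unfold dir, Re, Im. ring.
Qed.

Lemma pd_prol (X : framed) (i : coord X) (u : Cinf X) :
  pd (X := cyl X) (Some i) (prol u) = prol (pd i u).
Proof. now apply Cinf_ext. Qed.

Lemma pd_fibre_prol (X : framed) (u : Cinf X) :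
  pd (X := cyl X) None (prol u) = zero.
Proof.
apply Cinf_ext; intros x; apply injective_projections.
- exact (Derive_const (fst (u (fst x))) 0).
- exact (Derive_const (snd (u (fst x))) 0).
Qed.

Lemma pd_fibre_coord (X : framed) (i : coord X) :
  pd (X := cyl X) (Some i) (fibre_coord X) = zero.
Proof.
apply Cinf_ext; intros x; apply injective_projections.
- exact (Derive_const (snd x) 0).
- exact (Derive_const 0 0).
Qed.

Lemma pd_fibre_fibre_coord (X : framed) :
  pd (X := cyl X) None (fibre_coord X) = cinf_const 1.
Proof.
apply Cinf_ext; intros [x j].
apply (pd_real (cyl X)) with (h := fun t => j + t); [reflexivity|].
auto_derive; [exact I | ring].
Qed.

Lemma prol_const (X : framed) c : prol (@cinf_const X c) = cinf_const c.
Proof. now apply Cinf_ext. Qed.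

Lemma h0_prol (X : framed) (u : Cinf X) : h0 (prol u) = zero.
Proof.
apply Cinf_ext; intros y. simpl. unfold h0_fun.
destruct (Req_EM_T (snd y) 0) as [Hy|Hy].
- now rewrite pd_fibre_prol.
- simpl. unfold Cdiv. ring.
Qed.

Lemma pd_p_C (i : C_coord) :
  pd (X := Csurf) i p_C = cinf_const (match i with c_p => 1 | _ => 0 end).
Proof.
apply Cinf_ext; intros [[z q] w].
destruct i.
- apply pd_real with (h := fun _ => q); [reflexivity | apply is_derive_cst].
- apply pd_real with (h := fun t => q + t); [reflexivity|].
  auto_derive; [exact I | ring].
- apply pd_real with (h := fun _ => q); [reflexivity | apply is_derive_cst].
Qed.

Lemma pd_p_M (i : C_coord) :
  pd (X := M) (Some i) p_M = cinf_const (match i with c_p => 1 | _ => 0 end).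
Proof. unfold p_M, M. now rewrite pd_prol, pd_p_C, prol_const. Qed.

Lemma p_dJ_J_prol (u : Cinf Csurf) :
  p_dJ (cinf_mult J (prol u)) = cinf_mult p_M (prol u).
Proof.
unfold p_dJ, dJ, J, M. rewrite pd_mult, pd_fibre_fibre_coord, pd_fibre_prol.
apply Cinf_ext; intros x; simpl; ring.
Qed.

Lemma p_dJ_prol (u : Cinf Csurf) : p_dJ (prol u) = zero.
Proof.
unfold p_dJ, dJ, M. rewrite pd_fibre_prol.
apply Cinf_ext; intros x; simpl; ring.
Qed.

(** * Additivity of [star] in its second slot and its linearity in [lam] *)

Lemma bidiff_zero_r r : forall f, bidiff r f zero = zero.
Proof.
induction r as [|r IHr]; intros f; simpl.
- apply Cinf_ext; intros x; simpl; ring.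
- unfold dp, dpsi. rewrite !pd_zero, !IHr. apply plus_zero_r.
Qed.

Lemma bidiff_zero_l r : forall g, bidiff r zero g = zero.
Proof.
induction r as [|r IHr]; intros g; simpl.
- apply Cinf_ext; intros x; simpl; ring.
- unfold dphi, dJ. rewrite !pd_zero, !IHr. apply plus_zero_r.
Qed.

Lemma bidiff_plus_r r : forall f g g',
  bidiff r f (plus g g') = plus (bidiff r f g) (bidiff r f g').
Proof.
induction r as [|r IHr]; intros f g g'.
- apply Cinf_ext; intros x; simpl; ring.
- simpl. unfold dp, dpsi. rewrite !(proj1 (pd_linear M _)) by trivial.
  rewrite !IHr. apply Cinf_ext; intros x; simpl; ring.
Qed.

Lemma star_coef_plus_r r f g g' :
  star_coef r f (plus g g') = plus (star_coef r f g) (star_coef r f g').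
Proof.
unfold star_coef. rewrite bidiff_plus_r. exact (scal_distr_l (K := C_Ring) _ _ _).
Qed.

Lemma star_coef_zero_r r f : star_coef r f zero = zero.
Proof.
unfold star_coef. rewrite bidiff_zero_r. exact (scal_zero_r (K := C_Ring) _).
Qed.

Lemma star_coef_bidiff_zero r f g : bidiff r f g = zero -> star_coef r f g = zero.
Proof. unfold star_coef. intros ->. exact (scal_zero_r (K := C_Ring) _). Qed.

Lemma star_plus_r f g g' :
  star f (fun n => plus (g n) (g' n)) = fun n => plus (star f g n) (star f g' n).
Proof.
apply functional_extensionality. intros n. unfold star.
rewrite <- sum_n_plus. apply sum_n_ext. intros r.
rewrite <- sum_n_plus. apply sum_n_ext. intros a. apply star_coef_plus_r.
Qed.

Lemma star_lam_r f g : star f (lam g) = lam (star f g).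
Proof.
apply functional_extensionality. intros [|n]; unfold star; cbn [lam].
- rewrite !sum_O. apply star_coef_zero_r.
(* The summand [r = S n] meets only coefficient 0 of [lam g], which is zero. The same happens to the
   last [a] of every inner sum, and the rest is an index shift. *)
- rewrite sum_Sn, Nat.sub_diag, sum_O, star_coef_zero_r, plus_zero_r.
  apply sum_n_ext_loc. intros r Hr.
  replace (S n - r)%nat with (S (n - r)) by lia.
  rewrite sum_Sn, Nat.sub_diag, star_coef_zero_r, plus_zero_r.
  apply sum_n_ext_loc. intros a Ha.
  now replace (S (n - r) - a)%nat with (S (n - r - a)) by lia.
Qed.

Lemma star_lam_l f g : star (lam f) g = lam (star f g).
Proof.
apply functional_extensionality. intros [|n]; unfold star; cbn [lam].
- rewrite !sum_O. apply star_coef_zero.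
- rewrite sum_Sn, Nat.sub_diag, sum_O, star_coef_zero, plus_zero_r.
  apply sum_n_ext_loc. intros r Hr.
  replace (S n - r)%nat with (S (n - r)) by lia.
  (* With [lam] in the left slot it is the first summand, [a = 0], that vanishes, so the sum is
     opened from below and then reindexed. *)
  unfold sum_n at 1. rewrite sum_Sn_m by lia. cbn [lam].
  rewrite star_coef_zero, plus_zero_l, <- sum_n_m_S. reflexivity.
Qed.

(** * Star products and exponentials that stop after first order *)

Lemma sum_n_first_two (V : AbelianMonoid) (u : nat -> V) n :
  (forall k, u (S (S k)) = zero) ->
  sum_n u n = plus (u O) (match n with O => zero | S _ => u 1%nat end).
Proof.
intros H. destruct n as [|n]; [rewrite sum_O; symmetry; apply plus_zero_r|].
induction n as [|n IHn]; [now rewrite sum_Sn, sum_O|].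
now rewrite sum_Sn, IHn, H, plus_zero_r.
Qed.

(** A constant series has only its coefficient 0, which forces [a = n - r] in the double sum; the
    hypothesis then removes all orders [r >= 2]. *)
Lemma star_const_r f h : (forall r k, bidiff (S (S r)) (f k) h = zero) ->
  star f (fps_const h) =
  fun n => plus (cinf_mult (f n) h)
                (lam (fun k => scal (/ Ci : C_Ring)%C (bidiff 1 (f k) h)) n).
Proof.
intros H. apply functional_extensionality. intros n.
transitivity (sum_n (fun r => star_coef r (f (n - r)%nat) h) n).
- unfold star. apply sum_n_ext_loc. intros r Hr. rewrite fps_sum_last.
  + now rewrite Nat.sub_diag.
  + intros a Ha. replace (n - r - a)%nat with (S (n - r - a - 1)) by lia.
    apply star_coef_zero_r.
- rewrite sum_n_first_two by (intros; apply star_coef_bidiff_zero, H).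
  rewrite Nat.sub_0_r. destruct n as [|n]; cbn [lam];
    unfold star_coef; simpl pow; simpl fact; rewrite ?Nat.sub_0_r;
    change (INR 1) with 1; rewrite Rinv_1;
    apply Cinf_ext; intros x; simpl; rewrite ?Nat.sub_0_r; ring.
Qed.

Lemma star_const_l h g : (forall r k, bidiff (S (S r)) h (g k) = zero) ->
  star (fps_const h) g =
  fun n => plus (cinf_mult h (g n))
                (lam (fun k => scal (/ Ci : C_Ring)%C (bidiff 1 h (g k))) n).
Proof.
intros H. apply functional_extensionality. intros n.
transitivity (sum_n (fun r => star_coef r h (g (n - r)%nat)) n).
- unfold star. apply sum_n_ext_loc. intros r Hr. rewrite fps_sum_head.
  + now rewrite Nat.sub_0_r.
  + intros a Ha. apply star_coef_zero.
- rewrite sum_n_first_two by (intros; apply star_coef_bidiff_zero, H).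
  rewrite Nat.sub_0_r. destruct n as [|n]; cbn [lam];
    unfold star_coef; simpl pow; simpl fact; rewrite ?Nat.sub_0_r;
    change (INR 1) with 1; rewrite Rinv_1;
    apply Cinf_ext; intros x; simpl; rewrite ?Nat.sub_0_r; ring.
Qed.

Lemma exp_lam_nilpotent (V : ModuleSpace C_Ring) (D : V -> V) (f : fps V) :
  linear_on (fun _ => True) D -> (forall k, D (D (f k)) = zero) ->
  exp_lam D f = fun n => plus (f n) (lam (fun k => D (f k)) n).
Proof.
intros HD H. apply functional_extensionality. intros n. unfold exp_lam.
rewrite sum_n_first_two.
- simpl fact. change (INR 1) with 1. rewrite Rinv_1, Nat.sub_0_r.
  apply (f_equal2 plus); [exact (scal_one (K := C_Ring) (f n))|].
  destruct n as [|n]; [reflexivity|]. simpl. rewrite Nat.sub_0_r.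
  exact (scal_one (K := C_Ring) _).
(* Two copies of [D] are peeled off next to the argument, where they give zero; the remaining
   iterate is linear and preserves zero. *)
- intros k. rewrite !Nat.iter_succ_r, H, (Defs.linear_zero V _ (iter_linear V D k HD)).
  exact (scal_zero_r (K := C_Ring) _).
Qed.

(** * The equivalence [S] on functions affine in [J] *)

Lemma Sop_inv_J :
  Sop_inv (fps_const J) =
  fun n => plus (fps_const J n) (lam (fps_const (opp p_M)) n).
Proof.
assert (HJ : p_dJ J = p_M).
{ unfold p_dJ, dJ, J, M. rewrite pd_fibre_fibre_coord.
  apply Cinf_ext; intros x; simpl; ring. }
assert (H0 : p_dJ zero = zero) by exact (Defs.linear_zero _ _ p_dJ_linear).
assert (E : (fun k => opp (p_dJ (fps_const J k))) = fps_const (opp p_M)).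
{ apply functional_extensionality. intros [|k]; simpl fps_const.
  - now rewrite HJ.
  - etransitivity; [exact (f_equal opp H0)|].
    apply Cinf_ext; intros x; simpl; ring. }
unfold Sop_inv. rewrite exp_lam_nilpotent, E; [reflexivity | exact opp_p_dJ_linear |].
intros k. rewrite (equal_f E k).
replace (p_dJ (fps_const (opp p_M) k)) with (@zero (Cinf_AbelianMonoid M)).
- apply Cinf_ext; intros x; simpl; ring.
- destruct k as [|k]; simpl fps_const; [|now symmetry].
  (* The function [-p] comes from [Csurf], hence has no [J]-derivative, and the exponential stops at
     order one. *)
  replace (opp p_M) with (prol (opp p_C)) by now apply Cinf_ext.
  symmetry. apply p_dJ_prol.
Qed.

Lemma Sop_inv_prol (u : fps (Cinf Csurf)) :
  Sop_inv (fun n => prol (u n)) = fun n => prol (u n).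
Proof.
unfold Sop_inv. rewrite exp_lam_nilpotent; [|exact opp_p_dJ_linear|].
- apply functional_extensionality. intros n. rewrite <- plus_zero_r.
  apply (f_equal2 plus); [reflexivity|]. destruct n as [|n]; [reflexivity|].
  cbn [lam]. rewrite p_dJ_prol. apply Cinf_ext; intros x; simpl; ring.
- intros k. rewrite p_dJ_prol.
  etransitivity; [|exact (Defs.linear_zero _ _ opp_p_dJ_linear)].
  exact (f_equal (fun v => opp (p_dJ v)) (opp_zero (G := Cinf_AbelianGroup M))).
Qed.

(** [p_dJ] lowers the degree in [J]: it sends the affine series to [p prol u], which is again pulled
    back from [Csurf] and so is killed by a second application. *)
Lemma Sop_affine (u v : fps (Cinf Csurf)) :
  Sop (fun n => plus (cinf_mult J (prol (u n))) (prol (v n))) =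
  fun n => plus (plus (cinf_mult J (prol (u n))) (prol (v n)))
                (lam (fun k => cinf_mult p_M (prol (u k))) n).
Proof.
assert (H : forall k, p_dJ (plus (cinf_mult J (prol (u k))) (prol (v k))) =
                      cinf_mult p_M (prol (u k))).
{ intros k. rewrite (proj1 p_dJ_linear), p_dJ_J_prol, p_dJ_prol by trivial.
  apply plus_zero_r. }
unfold Sop. rewrite exp_lam_nilpotent; [|exact p_dJ_linear|].
- apply functional_extensionality. intros [|n]; cbn [lam]; now rewrite ?H.
- intros k. rewrite H.
  replace (cinf_mult p_M (prol (u k))) with (prol (cinf_mult p_C (u k)))
    by now apply Cinf_ext.
  apply p_dJ_prol.
Qed.

(** * Bidifferential operators with a constant, [J] or [-p] in one slot *)

Lemma bidiff_const_r r f c : bidiff (S r) f (cinf_const c) = zero.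
Proof.
simpl. unfold dp, dpsi. rewrite !pd_const, !bidiff_zero_r. apply plus_zero_r.
Qed.

Lemma bidiff_const_l r c g : bidiff (S r) (cinf_const c) g = zero.
Proof.
simpl. unfold dphi, dJ. rewrite !pd_const, !bidiff_zero_l. apply plus_zero_r.
Qed.

(** The second slot is differentiated only along [p] and [psi], and [J] depends on neither. *)
Lemma bidiff_J_r r f : bidiff (S r) f J = zero.
Proof.
simpl. unfold dp, dpsi, J, M. rewrite !pd_fibre_coord, !bidiff_zero_r.
apply plus_zero_r.
Qed.

Lemma bidiff_J_l r g : bidiff (S r) J g = bidiff r (cinf_const 1) (dpsi g).
Proof.
simpl. unfold dphi, dJ, J, M. rewrite pd_fibre_coord, pd_fibre_fibre_coord.
rewrite bidiff_zero_l. apply plus_zero_l.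
Qed.

Lemma pd_opp_p_M (i : C_coord) :
  pd (X := M) (Some i) (opp p_M) = cinf_const (match i with c_p => -(1) | _ => 0 end)%C.
Proof.
replace (opp p_M) with (scal (-(1) : C_Ring)%C p_M)
  by (apply Cinf_ext; intros x; simpl; ring).
rewrite (proj2 (pd_linear M _)), pd_p_M by trivial.
apply Cinf_ext; intros x; destruct i; simpl; ring.
Qed.

Lemma pd_fibre_opp_p_M : pd (X := M) None (opp p_M) = zero.
Proof. replace (opp p_M) with (prol (opp p_C)) by now apply Cinf_ext. apply pd_fibre_prol. Qed.

(** Only the pair [phi], [p] survives and leaves a constant behind, so a further order vanishes by
    [bidiff_const_r]. *)
Lemma bidiff_opp_p_r r f :
  bidiff (S r) f (opp p_M) = bidiff r (dphi f) (cinf_const (-(1))%C).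
Proof.
simpl. unfold dp, dpsi. rewrite !pd_opp_p_M.
change (@cinf_const M 0) with (@zero (Cinf_AbelianMonoid M)).
rewrite bidiff_zero_r. apply plus_zero_r.
Qed.

Lemma bidiff_opp_p_l r g : bidiff (S r) (opp p_M) g = zero.
Proof.
simpl. unfold dphi, dJ. rewrite pd_opp_p_M, pd_fibre_opp_p_M.
change (@cinf_const M 0) with (@zero (Cinf_AbelianMonoid M)).
rewrite !bidiff_zero_l. apply plus_zero_r.
Qed.

Lemma dphi_prol (u : Cinf Csurf) : dphi (prol u) = prol (pd (X := Csurf) c_phi u).
Proof. apply pd_prol. Qed.

Lemma dpsi_prol (u : Cinf Csurf) : dpsi (prol u) = prol (pd (X := Csurf) c_psi u).
Proof. apply pd_prol. Qed.

Lemma inv_Ci : (/ Ci)%C = (- Ci)%C.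
Proof. apply injective_projections; simpl; field. Qed.

(** * Star products with [J] and the quantum representation *)

Lemma star_t_prol_J (u : fps (Cinf Csurf)) :
  star_t (fun n => prol (u n)) (fps_const J) =
  fun n => plus (cinf_mult J (prol (u n)))
    (lam (lam (fun k => scal (Ci : C_Ring) (prol (pd (X := Csurf) c_phi (u k))))) n).
Proof.
unfold star_t. rewrite Sop_inv_prol, Sop_inv_J.
rewrite star_plus_r, star_lam_r.
rewrite star_const_r by (intros; apply bidiff_J_r).
rewrite star_const_r
  by (intros; rewrite bidiff_opp_p_r; apply bidiff_const_r).
(* This is the [J]-free part of the product [*] of [prol u] with [J - lambda p]. Its term
   [-lambda p u] is cancelled by the term that [S] creates from [J prol u]. *)
pose (v := lam (fun k => minus
  (lam (fun k => scal (Ci : C_Ring) (pd (X := Csurf) c_phi (u k))) k) (cinf_mult p_C (u k)))).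
etransitivity; [|etransitivity; [exact (Sop_affine u v)|]].
- f_equal. apply functional_extensionality.
  intros [|[|n]]; unfold v; cbn [lam]; rewrite ?bidiff_J_r, ?bidiff_opp_p_r, ?dphi_prol;
    apply Cinf_ext; intros x; simpl bidiff; simpl; rewrite ?inv_Ci; ring.
- apply functional_extensionality.
  intros [|[|n]]; unfold v; cbn [lam]; apply Cinf_ext; intros x; simpl; ring.
Qed.

Lemma star_t_J_prol (u : fps (Cinf Csurf)) :
  star_t (fps_const J) (fun n => prol (u n)) =
  fun n => plus (cinf_mult J (prol (u n)))
    (lam (fun k => opp (scal (Ci : C_Ring) (prol (pd (X := Csurf) c_psi (u k))))) n).
Proof.
unfold star_t. rewrite Sop_inv_prol, Sop_inv_J.
rewrite star_plus, star_lam_l.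
rewrite star_const_l
  by (intros; rewrite bidiff_J_l; apply bidiff_const_l).
rewrite star_const_l by (intros; apply bidiff_opp_p_l).
(* Again the [J]-free part before [S] is applied; here the [psi]-derivative already appears at order
   one, since [J] stands on the left. *)
pose (v := lam (fun k => opp
  (plus (scal (Ci : C_Ring) (pd (X := Csurf) c_psi (u k))) (cinf_mult p_C (u k))))).
etransitivity; [|etransitivity; [exact (Sop_affine u v)|]].
- f_equal. apply functional_extensionality.
  intros [|[|n]]; unfold v; cbn [lam]; rewrite ?bidiff_J_l, ?bidiff_opp_p_l, ?dpsi_prol;
    apply Cinf_ext; intros x; simpl bidiff; simpl; rewrite ?inv_Ci; ring.
- apply functional_extensionality.
  intros [|n]; unfold v; cbn [lam]; apply Cinf_ext; intros x; simpl; ring.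
Qed.

(** The commutator is [-i lambda d_psi - i lambda^2 d_phi] on pulled-back series; dividing by
    [i lambda] leaves one power of [lambda] on the [phi]-derivative. *)
Lemma rho_M_prol (u : fps (Cinf Csurf)) :
  rho_M star_t (fun n => prol (u n)) =
  fun n => prol (minus (opp (pd (X := Csurf) c_psi (u n)))
                       (lam (fun k => pd (X := Csurf) c_phi (u k)) n)).
Proof.
apply functional_extensionality. intros n. unfold rho_M, div_lam.
rewrite star_t_J_prol, star_t_prol_J, inv_Ci.
assert (HC : (Ci * Ci)%C = (-(1))%C) by (apply injective_projections; simpl; ring).
destruct n as [|n]; cbn [lam]; apply Cinf_ext; intros x; simpl; ring [HC].
Qed.

(** Since [h0] kills [prol v], the series [prol v] solves [g - lambda B1 h0 g = prol v], and
    [B1_h0_inverse] says that the solution is unique. Restricting it to [J = 0] returns [v]. *)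
Lemma q_iota_star_prol (v : fps (Cinf Csurf)) :
  q_iota_star star_t (fun n => prol (v n)) = v.
Proof.
assert (H : (fun n => prol (v n)) = inv_id_sub_lam
  (fun g => Defs.B1 star_t (fun k => h0 (g k))) (fun n => prol (v n))).
{ apply B1_h0_inverse. apply functional_extensionality. intros n.
  replace (fun k => h0 (prol (v k))) with (fun _ : nat => @zero (Cinf_AbelianMonoid M))
    by (apply functional_extensionality; intros k; symmetry; apply h0_prol).
  (* The zero series vanishes below order [S n], hence so does its product with [J], in particular
     at order [n]. *)
  rewrite B1_div_lam, (proj1 (star_t_low _ _ (S n) (fun _ _ => eq_refl))) by lia.
  apply Cinf_ext; intros x; simpl; ring. }
apply functional_extensionality. intros n. unfold q_iota_star.
rewrite <- H. now apply Cinf_ext.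
Qed.

Lemma rho_C_star_t (u : fps (Cinf Csurf)) :
  rho_C star_t u =
  fun n => minus (opp (pd (X := Csurf) c_psi (u n)))
                 (lam (fun k => pd (X := Csurf) c_phi (u k)) n).
Proof. unfold rho_C. rewrite rho_M_prol. apply q_iota_star_prol. Qed.

(** * Rotations, periodicity and functions invariant under a flow *)

(** The angle is [acos a] or [- acos a], according to the sign of the imaginary part [b]. *)
Lemma rot_transitive (z : circle) : exists t, z = rot t (Circle 1 Cmod_1).
Proof.
destruct z as [[a b] Hz].
assert (Hab : a * a + b * b = 1).
{ unfold Cmod in Hz. simpl fst in Hz. simpl snd in Hz.
  rewrite <- (sqrt_def (a * a + b * b)) by nra.
  replace (a * a + b * b) with (a ^ 2 + b ^ 2) by ring. rewrite Hz. ring. }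
assert (Ha : -1 <= a <= 1) by nra.
assert (Hs : sin (acos a) = sqrt (1 - a²)) by (apply sin_acos; exact Ha).
replace (1 - a²) with (b²) in Hs by (unfold Rsqr; lra).
rewrite sqrt_Rsqr_abs in Hs.
destruct (Rle_or_lt 0 b) as [Hb|Hb].
- exists (acos a). apply circle_ext; simpl. unfold expi.
  rewrite cos_acos, Hs, Rabs_pos_eq by assumption.
  apply injective_projections; simpl; ring.
- exists (- acos a). apply circle_ext; simpl. unfold expi.
  rewrite cos_neg, sin_neg, cos_acos, Hs, Rabs_left by assumption.
  apply injective_projections; simpl; ring.
Qed.

Lemma rot_2PI (z : circle) : rot (2 * PI) z = z.
Proof.
apply circle_ext; simpl. unfold expi. rewrite cos_2PI, sin_2PI. apply Cmult_1_r.
Qed.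

(** Subtracting [c * t] leaves a function with zero derivative, to which the mean value theorem
    applies. *)
Lemma Derive_const_affine (f : R -> R) c :
  (forall t, is_derive f t c) -> forall t, f t = f 0 + c * t.
Proof.
intros H t.
assert (Hg : forall s, is_derive (fun s => f s - c * s) s 0).
{ intros s. assert (Hl : is_derive (fun s => c * s) s c)
    by (auto_derive; [exact I | ring]).
  generalize (is_derive_minus (V := R_NormedModule) _ _ _ _ _ (H s) Hl).
  rewrite minus_eq_zero. exact (fun h => h). }
destruct (MVT_gen (fun s => f s - c * s) 0 t (fun _ => 0)) as (s & _ & Hs).
- intros s _. apply Hg.
- intros s _. apply continuity_pt_filterlim.
  exact (ex_derive_continuous (K := R_AbsRing) (V := R_NormedModule) _ _
           (ex_intro _ 0 (Hg s))).
- lra.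
Qed.

Lemma pd_along_flow (X : framed) (i : coord X) (f : Cinf X) x s :
  is_derive (fun t => fst (f (flow i t x))) s (fst (pd i f (flow i s x))) /\
  is_derive (fun t => snd (f (flow i t x))) s (snd (pd i f (flow i s x))).
Proof.
destruct (fn_smooth f 1%nat) as [H1 H2].
split; [exact (flow_derive X _ i x s H1) | exact (flow_derive X _ i x s H2)].
Qed.

Lemma pd_const_along_flow (X : framed) (i : coord X) (f : Cinf X) x c :
  (forall t, pd i f (flow i t x) = c) ->
  forall t, f (flow i t x) = (f x + c * RtoC t)%C.
Proof.
intros H t.
assert (H1 := Derive_const_affine (fun t => fst (f (flow i t x))) (fst c)).
assert (H2 := Derive_const_affine (fun t => snd (f (flow i t x))) (snd c)).
cbv beta in H1, H2. rewrite flow_0 in H1, H2.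
apply injective_projections.
- rewrite H1; [simpl; ring|]. intros s. rewrite <- (H s). exact (proj1 (pd_along_flow X i f x s)).
- rewrite H2; [simpl; ring|]. intros s. rewrite <- (H s). exact (proj2 (pd_along_flow X i f x s)).
Qed.

Lemma pd_zero_invariant (X : framed) (i : coord X) (f : Cinf X) :
  pd i f = zero <-> forall t x, f (flow i t x) = f x.
Proof.
split.
- intros H t x. rewrite (pd_const_along_flow X i f x 0); [ring|].
  intros s. now rewrite H.
- intros H. apply Cinf_ext. intros x. apply injective_projections.
  + etransitivity; [|exact (Derive_const (fst (f x)) 0)].
    apply Derive_ext. intros t. now rewrite H.
  + etransitivity; [|exact (Derive_const (snd (f x)) 0)].
    apply Derive_ext. intros t. now rewrite H.
Qed.

(** Invariance of [f] under flow [j] passes to the derivative along [i], because the curves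
    [s |-> flow i s x] are carried to one another by flow [j]. *)
Lemma pd_pd_zero_commuting_flow (X : framed) (i j : coord X) (f : Cinf X) :
  (forall s t x, flow i s (flow j t x) = flow j t (flow i s x)) ->
  pd j f = zero -> pd j (pd i f) = zero.
Proof.
intros Hc H. rewrite pd_zero_invariant in H. apply pd_zero_invariant. intros t x.
apply injective_projections; apply Derive_ext; intros s; now rewrite Hc, H.
Qed.

(* Along a closed orbit a function cannot grow at constant nonzero rate. *)
Lemma pd_periodic_zero (X : framed) (i : coord X) (T : R) (f : Cinf X) :
  T <> 0 -> (forall x, flow i T x = x) -> pd i (pd i f) = zero -> pd i f = zero.
Proof.
intros HT Hp H. rewrite pd_zero_invariant in H. apply Cinf_ext. intros x.
assert (E := pd_const_along_flow X i f x (pd i f x) (fun t => H t x) T).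
rewrite Hp in E.
assert (E' : (pd i f x * RtoC T)%C = 0).
{ transitivity (f x + pd i f x * RtoC T - f x)%C; [ring|]. rewrite <- E. ring. }
transitivity (pd i f x * RtoC T / RtoC T)%C.
- field. intros E0. apply HT. now apply RtoC_inj.
- rewrite E'. simpl. unfold Cdiv. ring.
Qed.

Lemma C_flow_phi_psi s t x :
  C_flow c_phi s (C_flow c_psi t x) = C_flow c_psi t (C_flow c_phi s x).
Proof. now destruct x as [[z q] w]. Qed.

Lemma C_flow_psi_2PI x : C_flow c_psi (2 * PI) x = x.
Proof. destruct x as [[z q] w]; simpl. now rewrite rot_2PI. Qed.

Lemma depends_only_on_p_pd (u : fps (Cinf Csurf)) :
  depends_only_on_p u <->
  forall n, pd (X := Csurf) c_phi (u n) = zero /\ pd (X := Csurf) c_psi (u n) = zero.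
Proof.
split.
- intros [v Hv] n.
  split; apply pd_zero_invariant; intros t [[z q] w]; simpl; now rewrite !Hv.
(* The value over [p] is read off at [z = w = 1]; rotations connect every other point of that fibre
   to this one. *)
- intros H. exists (fun n q => u n (Circle 1 Cmod_1, q, Circle 1 Cmod_1)).
  intros n z q w. destruct (H n) as [H1 H2].
  rewrite pd_zero_invariant in H1, H2.
  destruct (rot_transitive z) as [s ->], (rot_transitive w) as [t ->].
  etransitivity; [exact (H1 s (_, q, rot t _))|]. exact (H2 t (_, q, _)).
Qed.

Lemma minus_opp_zero (G : AbelianGroup) (a b : G) :
  minus (opp a) b = zero -> a = opp b.
Proof.
intros H. apply (plus_reg_l (opp a)). exact (eq_trans (plus_opp_l a) (eq_sym H)).
Qed.

(** * Solving the invariance equation order by order *)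

Lemma quantum_invariant_only_p (u : fps (Cinf Csurf)) :
  rho_C star_t u = (fun _ => zero) <-> depends_only_on_p u.
Proof.
rewrite rho_C_star_t, depends_only_on_p_pd. split.
- intros H.
  assert (H0 : pd (X := Csurf) c_psi (u O) = zero).
  { etransitivity; [exact (minus_opp_zero _ _ _ (equal_f H O))|].
    exact (opp_zero (G := Cinf_AbelianGroup Csurf)). }
  assert (HS : forall n, pd (X := Csurf) c_psi (u (S n)) =
                         opp (pd (X := Csurf) c_phi (u n)))
    by (intros n; exact (minus_opp_zero _ _ _ (equal_f H (S n)))).
  assert (Hpsi : forall n, pd (X := Csurf) c_psi (u n) = zero).
  { induction n as [|n IHn]; [exact H0|].
    (* The [psi]-orbits close after [2 * PI]. By [HS] the second [psi]-derivative vanishes once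
       [d_phi u_n] is [psi]-invariant, which follows from the induction hypothesis because the two
       flows commute. *)
    apply pd_periodic_zero with (T := 2 * PI).
    - generalize PI_RGT_0; lra.
    - exact C_flow_psi_2PI.
    - rewrite HS. apply pd_zero_invariant. intros t x. simpl fn.
      assert (E := pd_pd_zero_commuting_flow Csurf c_phi c_psi (u n)
                     C_flow_phi_psi IHn).
      rewrite pd_zero_invariant in E. exact (f_equal Copp (E t x)). }
  (* The equation at order [S n] now expresses [d_phi u_n] through the vanishing [d_psi u_(n+1)]. *)
  intros n. split; [|apply Hpsi].
  rewrite <- (opp_opp (G := Cinf_AbelianGroup Csurf) (pd (X := Csurf) c_phi (u n))).
  etransitivity; [exact (f_equal opp (eq_trans (eq_sym (HS n)) (Hpsi (S n))))|].
  exact (opp_zero (G := Cinf_AbelianGroup Csurf)).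
- intros H. apply functional_extensionality. intros n.
  destruct n as [|n]; cbn [lam]; rewrite (proj2 (H _)), ?(proj1 (H n));
    apply Cinf_ext; intros x; simpl; ring.
Qed.

(** * The classical invariant [z] obstructs a deformation *)

(** The [phi]-derivative exchanges the real and imaginary parts of [z] up to sign, so the induction
    must treat both together. *)
Lemma Ck_circle n :
  @Ck Csurf n (fun x => fst (cval (fst (fst x)))) /\
  @Ck Csurf n (fun x => snd (cval (fst (fst x)))).
Proof.
assert (Hv : forall x : Csurf, continuous (fun x : Csurf => cval (fst (fst x))) x).
{ intros x. apply (continuous_comp (fun x : Csurf => fst (fst x)) cval).
  - apply (continuous_comp fst fst); apply cont_fst.
  - apply filterlim_locally. intros e. exists e. intros w Hw. exact Hw. }
assert (H1 : forall x : Csurf, continuous (fun x : Csurf => fst (cval (fst (fst x)))) x).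
{ intros x. apply (continuous_comp (fun x : Csurf => cval (fst (fst x))) fst);
    [apply Hv | apply cont_fst]. }
assert (H2 : forall x : Csurf, continuous (fun x : Csurf => snd (cval (fst (fst x)))) x).
{ intros x. apply (continuous_comp (fun x : Csurf => cval (fst (fst x))) snd);
    [apply Hv | apply cont_snd]. }
induction n as [|n [I1 I2]]; [repeat split; assumption|]. split.
- apply (Ck_step Csurf) with (g := fun i x =>
    match i with c_phi => - snd (cval (fst (fst x))) | _ => 0 end); [exact H1 | |].
  + intros [| |] [[z q] w]; simpl; auto_derive; try exact I;
      rewrite ?sin_0, ?cos_0; ring.
  + intros [| |]; [apply Ck_opp, I2 | apply Ck_const | apply Ck_const].
- apply (Ck_step Csurf) with (g := fun i x =>
    match i with c_phi => fst (cval (fst (fst x))) | _ => 0 end); [exact H2 | |].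
  + intros [| |] [[z q] w]; simpl; auto_derive; try exact I;
      rewrite ?sin_0, ?cos_0; ring.
  + intros [| |]; [exact I1 | apply Ck_const | apply Ck_const].
Qed.

Definition z_C : Cinf Csurf :=
  MkCinf (X := Csurf) (fun x => cval (fst (fst x))) Ck_circle.

Lemma not_consistent_quantum_reduction : ~ consistent_quantum_reduction star_t.
Proof.
intros (E & _ & HE0 & HE).
assert (Hz : classical_invariant z_C).
{ apply pd_zero_invariant. now intros t [[z q] w]. }
(* Only the leading coefficient matters: at order 0 the deformation is the inclusion, so the image
   series begins with [z]. *)
set (W := fun _ : nat => z_C).
assert (HW := proj2 (HE _) (ex_intro _ W (conj (fun _ => Hz) eq_refl))).
apply quantum_invariant_only_p in HW. destruct HW as [v Hv].
assert (Hval : forall z, v O 0 = cval z).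
{ intros z. rewrite <- (Hv O z 0 z), sum_O, Nat.sub_0_r. unfold W.
  now rewrite HE0. }
(* A function of [p] alone would take the same value at [z = 1] and [z = -1]. *)
assert (H := eq_trans (eq_sym (Hval (rot 0 (Circle 1 Cmod_1))))
               (Hval (rot PI (Circle 1 Cmod_1)))).
apply (f_equal fst) in H. simpl in H. rewrite cos_0, cos_PI in H. lra.
Qed.

Theorem mainTheorem8 :
  (forall u : fps (Cinf Csurf),
     rho_C star_t u =
     fun n => minus (opp (pd (X := Csurf) c_psi (u n)))
                    (lam (fun k => pd (X := Csurf) c_phi (u k)) n)) /\
  (forall u : fps (Cinf Csurf),
     rho_C star_t u = (fun _ => zero) <-> depends_only_on_p u) /\
  ~ consistent_quantum_reduction star_t.
Proof.
exact (conj rho_C_star_t (conj quantum_invariant_only_p not_consistent_quantum_reduction)).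
Qed.
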